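(* Let $n=3$. If $H(\alpha,\beta)$ is not finite, then it is hyperbolic, i.e. it preserves a nondegenerate rational quadratic form $f$ (unique up to a scalar) of signature $(2,1)$. Moreover the six hyperbolic groups $H(\alpha,\beta)$ in dimension $3$, given by 1. $\alpha=(\frac12,\frac12,\frac12)$, $\beta=(0,0,0)$; 2. $\alpha=(\frac13,\frac12,\frac23)$, $\beta=(0,0,0)$; 3. $\alpha=(\frac14,\frac12,\frac34)$, $\beta=(0,0,0)$; 4. $\alpha=(\frac16,\frac12,\frac56)$, $\beta=(0,0,0)$; 5. $\alpha=(\frac13,\frac12,\frac23)$, $\beta=(0,\frac14,\frac34)$; 6. $\alpha=(\frac13,\frac12,\frac23)$, $\beta=(0,\frac16,\frac56)$, are all arithmetic.
   Context: For $\alpha,\beta\in(\mathbb Q\cap[0,1))^n$ (regarded as multisets) with $\alpha_i\neq\beta_j$ for all $i,j$, put $P(z)=\prod_{j}(z-e^{2\pi i\alpha_j})=z^n+A_1z^{n-1}+\cdots+A_n$ and $Q(z)=\prod_{j}(z-e^{2\pi i\beta_j})=z^n+B_1z^{n-1}+\cdots+B_n$, assumed to be products of cyclotomic polynomials. $H(\alpha,\beta)\subset \mathrm{GL}_n(\mathbb Z)$ is the group generated by the companion matrices $A$ and $B$ of $P$ and $Q$: $A e_i=e_{i+1}$ for $1\le i<n$ and $Ae_n=-A_ne_1-A_{n-1}e_2-\cdots-A_1e_n$; similarly for $B$ with the coefficients $B_i$. It is assumed throughout that $H(\alpha,\beta)$ is primitive: there is no decomposition $\mathbb C^n=V_1\oplus\cdots\oplus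 V_k$, $k>1$, $\dim V_i\ge1$, whose summands are permuted by $H(\alpha,\beta)$. A hyperbolic $H(\alpha,\beta)$ preserving $f$ is arithmetic if it has finite index in $\mathrm O_f(\mathbb Z)=\{g\in\mathrm{GL}_n(\mathbb Z): f\circ g=f\}$. The list of six groups is understood up to scalar shift ($\alpha,\beta$ replaced by $\alpha+d,\beta+d$ modulo $1$) and interchange of $\alpha$ and $\beta$. *)

(* Defs.v *)
From HB Require Import structures.
From mathcomp Require Import all_boot all_order all_algebra all_fingroup all_field.
From mathcomp Require Import all_classical all_reals all_analysis.
From mathcomp Require Import complex.
Set Implicit Arguments.
Unset Strict Implicit.
Unset Printing Implicit Defensive.
Import Order.TTheory GRing.Theory Num.Theory.
Local Open Scope classical_set_scope.
Local Open Scope ring_scope.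

(* e^{2 pi i a} *)
Definition e2pi (R : realType) (a : rat) : R[i] :=
  Complex (cos (2 * pi * ratr a)) (sin (2 * pi * ratr a)).

(* \prod_j (z - e^{2 pi i alpha_j}) *)
Definition exp_poly (R : realType) (n : nat) (alpha : n.-tuple rat) :
    {poly R[i]} :=
  \prod_(a <- alpha) ('X - (e2pi R a)%:P).

Definition cyclotomic_product (R : realType) (p : {poly R[i]}) : Prop :=
  exists2 s : seq nat, all (ltn 0) s &
    p = map_poly intr (\prod_(k <- s) 'Phi_k).

Definition hg_data (R : realType) (n : nat) (alpha beta : n.-tuple rat) :
    Prop :=
  [/\ all (fun a => 0 <= a < 1) alpha /\ all (fun b => 0 <= b < 1) beta,
      (forall i j, tnth alpha i != tnth beta j),
      cyclotomic_product (exp_poly R alpha)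
    & cyclotomic_product (exp_poly R beta)].

(* For p monic of degree n this is the companion matrix acting on column
   vectors: e_i |-> e_{i+1} for i < n, and e_n |-> - \sum_i p`_(i-1) e_i.
   It is the transpose of mathcomp's [companionmx], whose dimension
   [(size p).-1] is moreover not syntactically n. *)
Definition comp_mx (K : nzRingType) (n : nat) (p : {poly K}) : 'M[K]_n :=
  \matrix_(i, j) (if j.+1 == n :> nat then - p`_i else (i == j.+1 :> nat)%:R).

(* Subgroup of GL_n(K) generated by a set of invertible matrices. *)
Inductive gen_group (K : comUnitRingType) (n : nat) (S : set 'M[K]_n) :
    'M[K]_n -> Prop :=
| gen_group_in g of S g : gen_group S g
| gen_group_1 : gen_group S 1%:M
| gen_group_mul g h of gen_group S g & gen_group S h : gen_group S (g *m h)
| gen_group_inv g of gen_group S g : gen_group S (invmx g).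

(* H(alpha, beta), as a set of complex matrices; under [hg_data] it consists
   of integral matrices. *)
Definition hg_group (R : realType) (n : nat) (alpha beta : n.-tuple rat) :
    set 'M[R[i]]_n :=
  gen_group [set comp_mx n (exp_poly R alpha); comp_mx n (exp_poly R beta)].
Arguments hg_group R {n} alpha beta _.

Definition permutes (K : fieldType) (n k : nat) (h : 'M[K]_n)
    (V : 'I_k -> {vspace 'cV[K]_n}) : Prop :=
  exists s : 'S_k, forall i, (linfun (mulmx h) @: V i)%VS = V (s i).

Definition primitive_group (K : fieldType) (n : nat) (H : set 'M[K]_n) : Prop :=
  ~ exists k : nat, exists V : 'I_k -> {vspace 'cV[K]_n},
    [/\ (1 < k)%N,
        (forall i, 0 < \dim (V i))%N,
        (\sum_(i < k) V i = fullv)%VS,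
        directv (\sum_(i < k) V i)%VS
      & forall h, H h -> permutes h V].

(* A rational quadratic form is given by a symmetric rational matrix. *)
Definition qform (K : unitRingType) (n : nat) (F : 'M[rat]_n) (x : 'cV[K]_n) :
    K :=
  (x^T *m map_mx ratr F *m x) 0 0.

Definition preserves (K : unitRingType) (n : nat) (F : 'M[rat]_n)
    (g : 'M[K]_n) : Prop :=
  forall x : 'cV[K]_n, qform F (g *m x) = qform F x.

(* Diagonalizing over rat rather than over the reals is no restriction, and by
   Sylvester's law of inertia p and q do not depend on the diagonalization. *)
Definition has_signature (n : nat) (F : 'M[rat]_n) (p q : nat) : Prop :=
  exists S : 'M[rat]_n, exists d : 'rV[rat]_n,
    [/\ S \in unitmx, S^T *m F *m S = diag_mx d,
        #|[set i | 0 < d 0 i]%SET| = p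
      & #|[set i | d 0 i < 0]%SET| = q].

Definition hyperbolic_form (K : unitRingType) (n : nat) (H : set 'M[K]_n)
    (F : 'M[rat]_n) : Prop :=
  [/\ F^T = F, \det F != 0, has_signature F n.-1 1
    & forall h, H h -> preserves F h].

Definition hyperbolic (K : unitRingType) (n : nat) (H : set 'M[K]_n) : Prop :=
  exists F : 'M[rat]_n, hyperbolic_form H F.

(* O_F(Z) = {g in GL_n(Z) : F o g = F}, embedded in the complex matrices. *)
Definition ortho_int (R : realType) (n : nat) (F : 'M[rat]_n) :
    set 'M[R[i]]_n :=
  [set map_mx intr g | g in [set g : 'M[int]_n |
     g \in unitmx /\ preserves F (map_mx intr g : 'M[R[i]]_n)]].
Arguments ortho_int R {n} F _.

(* H is contained in G and has finitely many left cosets in G. *)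
Definition finite_index (K : pzRingType) (n : nat) (H G : set 'M[K]_n) : Prop :=
  H `<=` G /\ finite_set [set [set g *m h | h in H] | g in G].

(* For the groups considered here F is unique up to a scalar, so the choice of F
   does not matter. *)
Definition is_arithmetic (R : realType) (n : nat) (H : set 'M[R[i]]_n) : Prop :=
  exists2 F : 'M[rat]_n, hyperbolic_form H F & finite_index H (ortho_int R F).
Arguments is_arithmetic {R n} H.

(* a + d modulo 1, in [0, 1) *)
Definition shift1 (d a : rat) : rat := a + d - (Num.floor (a + d))%:~R.

(* Equality of pairs of multisets up to a scalar shift and interchange. *)
Definition hg_equiv (n : nat) (alpha beta alpha' beta' : n.-tuple rat) : Prop :=
  exists d : rat,
    (perm_eq alpha' (map (shift1 d) alpha) /\
     perm_eq beta' (map (shift1 d) beta)) \/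
    (perm_eq alpha' (map (shift1 d) beta) /\
     perm_eq beta' (map (shift1 d) alpha)).

Definition hg_six : seq (3.-tuple rat * 3.-tuple rat) :=
  [:: ([tuple 1/2; 1/2; 1/2], [tuple 0; 0; 0]);
      ([tuple 1/3; 1/2; 2/3], [tuple 0; 0; 0]);
      ([tuple 1/4; 1/2; 3/4], [tuple 0; 0; 0]);
      ([tuple 1/6; 1/2; 5/6], [tuple 0; 0; 0]);
      ([tuple 1/3; 1/2; 2/3], [tuple 0; 1/4; 3/4]);
      ([tuple 1/3; 1/2; 2/3], [tuple 0; 1/6; 5/6])].

(* Main.v *)
Require Import Defs.
From mathcomp Require Import all_boot all_order all_algebra all_fingroup all_field.
From mathcomp Require Import all_classical all_reals all_analysis.
From mathcomp Require Import complex.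
From mathcomp Require Import zify ring lra.
Import Order.TTheory GRing.Theory Num.Theory.
Local Open Scope classical_set_scope.
Local Open Scope ring_scope.

(** Each of the two cubics has integer coefficients and all its roots on the
    unit circle.  Comparing such a cubic with its conjugate reciprocal shows
    that it is P_t = (X + 1)(X^2 + tX + 1) or Q_s = (X - 1)(X^2 + sX + 1) with
    |s|, |t| <= 2, and disjointness of the roots leaves one P_t and one Q_s with
    -1 <= t <= 2, -2 <= s <= 1 and s <> t ([hg_classify]).  So every group is
    [hgK s t], generated by the companion matrices A of P_t and B of Q_s, and
    the arguments below are uniform in the integers s and t.

    Invariance under A and B is a linear condition on symmetric matrices whose
    solutions are the multiples of one Toeplitz form f ([gram_unique]).  By

      p f(x,y,z) = k (p (x - z)^2 - (t - s)(x + z)^2) + (p y - (t + s)(x + z))^2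

    with p = 4 + t - s and k = (2 + t)(2 - s) ([hform_sq]), the form is positive
    definite if t < s, in which case the group is finite and no invariant form
    has signature (2,1), whereas f has signature (2,1) if s < t.

    Arithmeticity for s < t is reduction theory in the hyperbolic plane of lines
    on which f < 0.  There A is a rotation about the line of a = (1, t, 1) and B
    a rotation about the line of b = (1, s, 1), these being cusps if t = 2 or
    s = -2.  A Dirichlet domain centred on the segment ab, with respect to A, B
    and their inverses, is the kite with vertices a, b, w = (2, t+s, 2+t-s) and
    the mirror image of w under x <-> z; the distance to the centre is measured
    by |x + z|.  An integral vector of norm -m outside the kite is moved by one
    of the four elements to a vector with smaller |x + z| ([descent]).  Inside
    the kite, t - s times the vector has nonnegative integral coordinates on the
    vertices, whose mutual products are nonpositive, and this bounds the vector
    in terms of m ([reduced_bounded]).  Hence H has finitely many orbits, up to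
    sign, on integral vectors of norm -m; as the stabilizer in O_f(Z) of one
    such vector is finite, H has finite index ([orthoZ_cosets]).

    Up to the shift by 1/2, which exchanges (s, t) and (-t, -s), the pairs with
    s < t are the six of the list ([six_or_twist]).  Conversely a shift by d
    multiplies the sums of the roots by e^{2 pi i d}, so that 1 + t and 1 - s are
    invariants of the pair up to order, and every pair equivalent to one of the
    six has s < t ([equiv_indefinite]).  Primitivity of the six
    ([hgK_primitive]) comes from traces: a permutation of three independent
    lines without fixed line has trace zero, so the nonzero traces of B, A^-1 B
    and A B^2 give a line fixed by both A and B, and A and B have no common
    eigenvector. *)

(** * The family of groups and the invariant form *)

Definition col3 {K : nzRingType} (x y z : K) : 'cV[K]_3 :=
  \col_i [:: x; y; z]`_i.

Lemma col3_eta {K : nzRingType} (x : 'cV[K]_3) :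
  x = col3 (x 0 0) (x 1 0) (x 2%:R 0).
Proof.
apply/matrixP => i j; rewrite mxE ord1.
by case: i => [[|[|[|//]]] lti] /=; congr (x _ 0); apply/val_inj.
Qed.

Lemma comp_mx_col3 {K : nzRingType} (p : {poly K}) (x y z : K) :
  comp_mx 3 p *m col3 x y z = col3 (- p`_0 * z) (x - p`_1 * z) (y - p`_2 * z).
Proof.
apply/matrixP => i j; rewrite !mxE !big_ord_recl big_ord0 !mxE /=.
by case: i => [[|[|[|//]]] lti] /=;
  rewrite ?mulNr ?mul0r ?mul1r ?add0r ?addr0.
Qed.

(** The expansion of (X + 1)(X^2 + tX + 1). *)
Definition poly_plus (t : int) : {poly int} := Poly [:: 1; 1 + t; 1 + t; 1].
(** The expansion of (X - 1)(X^2 + sX + 1). *)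
Definition poly_minus (s : int) : {poly int} := Poly [:: -1; 1 - s; s - 1; 1].

(** Both companion matrices send e_1 to e_2 and e_2 to e_3, so an invariant form
    has a Toeplitz matrix, with entries p, q, r say; the images of e_3 under A and
    B give the two linear equations 2q + (s-1)(p-q) + (1+t)(p+q) = 0 and
    r = q + (s-1)(p-q), solved by p = 4+t-s, q = -(t+s), r = 3s-3t+2ts-4 and
    their multiples. *)
Definition hform {K : nzRingType} (s t x y z : K) : K :=
  (4 + t - s) * (x * x + y * y + z * z) - 2 * (t + s) * (y * (x + z))
  + 2 * (3 * s - 3 * t + 2 * (t * s) - 4) * (x * z).

Definition gram (s t : int) : 'M[rat]_3 :=
  \matrix_(i, j) ([:: 4 + t - s; - (t + s); 3 * s - 3 * t + 2 * (t * s) - 4]`_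
     `|(i : nat)%:Z - (j : nat)%:Z|%N)%:~R.

Lemma qform_gram {K : fieldType} (s t : int) (x y z : K) :
  qform (gram s t) (col3 x y z) = hform s%:~R t%:~R x y z.
Proof.
rewrite /qform /hform !mxE !big_ord_recl !big_ord0 !mxE !big_ord_recl !big_ord0.
rewrite !mxE /= !ratr_int.
rewrite !(rmorphD, rmorphB, rmorphM, rmorphN) /=; ring.
Qed.

Definition hformZ (s t : int) (x : 'cV[int]_3) : int :=
  hform s t (x 0 0) (x 1 0) (x 2%:R 0).

Lemma qform_hformZ {K : fieldType} (s t : int) (x : 'cV[int]_3) :
  qform (gram s t) (map_mx intr x : 'cV[K]_3) = (hformZ s t x)%:~R.
Proof.
rewrite [map_mx _ _]col3_eta qform_gram !mxE /hformZ /hform.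
by rewrite !(rmorphD, rmorphB, rmorphM, rmorphN).
Qed.

Lemma poly_plus_coef t : ((poly_plus t)`_0 = 1) * ((poly_plus t)`_1 = 1 + t)
  * ((poly_plus t)`_2 = 1 + t).
Proof. by rewrite !coef_Poly. Qed.
Lemma poly_minus_coef s : ((poly_minus s)`_0 = -1) * ((poly_minus s)`_1 = 1 - s)
  * ((poly_minus s)`_2 = s - 1).
Proof. by rewrite !coef_Poly. Qed.

Definition mxA {K : nzRingType} (t : int) : 'M[K]_3 := comp_mx 3 (map_poly intr (poly_plus t)).
Definition mxB {K : nzRingType} (s : int) : 'M[K]_3 := comp_mx 3 (map_poly intr (poly_minus s)).

Lemma mxA_col3 {K : nzRingType} t (x y z : K) :
  mxA t *m col3 x y z = col3 (- z) (x - (1 + t%:~R) * z) (y - (1 + t%:~R) * z).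
Proof.
by rewrite comp_mx_col3 !coef_map !poly_plus_coef /= !intrD mulN1r.
Qed.
Lemma mxB_col3 {K : nzRingType} s (x y z : K) :
  mxB s *m col3 x y z = col3 z (x - (1 - s%:~R) * z) (y - (s%:~R - 1) * z).
Proof.
by rewrite comp_mx_col3 !coef_map !poly_minus_coef /= !intrB mulrN1z opprK mul1r.
Qed.

Lemma mxA_form {K : comNzRingType} (s t : int) (x y z : K) : 
  hform s%:~R t%:~R (- z) (x - (1 + t%:~R) * z) (y - (1 + t%:~R) * z) = hform s%:~R t%:~R x y z.
Proof. rewrite /hform; ring. Qed.
Lemma mxB_form {K : comNzRingType} (s t : int) (x y z : K) : 
  hform s%:~R t%:~R z (x - (1 - s%:~R) * z) (y - (s%:~R - 1) * z) = hform s%:~R t%:~R x y z.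
Proof. rewrite /hform; ring. Qed.

(** The three squares belong to a basis orthogonal for the form; the
    sign of t - s decides between definite and signature (2,1). *)
Lemma hform_sq {K : comNzRingType} (s t x y z : K) :
  (4 + t - s) * hform s t x y z =
    (2 + t) * (2 - s) * ((4 + t - s) * (x - z) ^+ 2 - (t - s) * (x + z) ^+ 2)
    + ((4 + t - s) * y - (t + s) * (x + z)) ^+ 2.
Proof. rewrite /hform; ring. Qed.

(** The numbers na, nb, nc are the coordinates of (t - s)(x, y, z) on the
    vertices (1, t, 1), (1, s, 1) and (2, t+s, 2+t-s) of the reduction domain, and
    the right-hand side is -1/(t - s) times the form in these coordinates.  All
    its coefficients are nonnegative for -2 <= s < t <= 2. *)
Lemma kite_form {K : comNzRingType} (s t x y z na nb nc : K) :
  na = y - z + (1 - s) * x -> nb = (1 + t) * x - y - z -> nc = z - x ->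
  - (t - s) * hform s t x y z = (4 - t ^+ 2) * na ^+ 2 + (4 - s ^+ 2) * nb ^+ 2
   + (2 + t) * (2 - s) * (4 * nc ^+ 2 + 2 * na * nb + 4 * na * nc + 4 * nb * nc).
Proof. move=> -> -> ->; rewrite /hform; ring. Qed.

(** * Reduction of integral vectors *)

(** On vectors of negative norm the form forces (x - z)^2 < (x + z)^2.  This
    makes x + z, which is never zero there, a sign for the two sheets. *)
Lemma negative_cone (s t x y z : int) :
  -2 <= s -> s < t -> t <= 2 -> hform s t x y z < 0 -> 0 < x * z.
Proof.
move=> hs hst ht hneg.
have := hform_sq s t x y z.
set h := hform _ _ _ _ _ in hneg *.
set k := (2 + t) * (2 - s); set Y := _ - _ * (x + z) => E.
have k0 : 0 < k by rewrite /k; nia.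
have : (4 + t - s) * h < 0 by nia.
rewrite E => E1.
have Y0 : 0 <= Y ^+ 2 by exact: sqr_ge0.
have E2 : (4 + t - s) * (x - z) ^+ 2 - (t - s) * (x + z) ^+ 2 < 0 by nia.
have X0 : 0 <= (x - z) ^+ 2 by exact: sqr_ge0.
have : (t - s) * (x - z) ^+ 2 < (t - s) * (x + z) ^+ 2 by nia.
rewrite ltr_pM2l ?subr_gt0 // => {E E1 E2 X0 Y0}; rewrite !expr2; nia.
Qed.

(** The coefficients a and b vanish when the corresponding vertex is a cusp.  The
    coordinate d is then controlled by the cross terms with e and f, unless
    e = f = 0; in that case a d^2 = m > 0 shows that a is positive. *)
Lemma sum_sq_bound (a b c d e f m : int) : 
  0 <= a -> 0 <= b -> 0 < c -> 0 <= d -> 0 <= e -> 0 <= f -> 0 < m ->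
  a * d ^+ 2 + b * e ^+ 2 + c * (4 * f ^+ 2 + 2 * d * e + 4 * d * f + 4 * e * f) = m ->
  [/\ d <= m, e <= m & f <= m].
Proof.
move=> ha hb hc hd he hf hm.
have le_sq (u : int) : 0 <= u -> u <= u ^+ 2 by move=> ?; rewrite expr2; nia.
have := le_sq _ hd; have := le_sq _ he; have := le_sq _ hf.
set d2 := d ^+ 2; set e2 := e ^+ 2; set f2 := f ^+ 2 => Hf He Hd E.
have de0 : 0 <= d * e by exact: mulr_ge0.
have df0 : 0 <= d * f by exact: mulr_ge0.
have ef0 : 0 <= e * f by exact: mulr_ge0.
have ad0 : 0 <= a * d2 by apply: mulr_ge0 => //; apply: le_trans Hd.
have be0 : 0 <= b * e2 by apply: mulr_ge0 => //; apply: le_trans He.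
have le_c (u : int) : 0 <= u -> u <= c * u by nia.
have S : 4 * f2 + 2 * d * e + 4 * d * f + 4 * e * f <= m.
  apply: le_trans (le_c _ _) _; first by nia.
  by nia.
split; last by nia.
- have [e0|e0] := eqVneq e 0; last first.
    have : d <= d * e by nia.
    by nia.
  have [f0|f0] := eqVneq f 0; last by nia.
  have f20 : f2 = 0 by rewrite /f2 f0 expr0n.
  have e20 : e2 = 0 by rewrite /e2 e0 expr0n.
  move: E; rewrite e0 f0 f20 e20 !(mulr0, mul0r, addr0, add0r) => E.
  have : a != 0 by apply: contraTneq hm => a0; rewrite -E a0 mul0r.
  by move=> ?; nia.
- have [d0|d0] := eqVneq d 0; last first.
    have : e <= d * e by nia.
    by nia.
  have [f0|f0] := eqVneq f 0; last by nia.
  have f20 : f2 = 0 by rewrite /f2 f0 expr0n.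
  have d20 : d2 = 0 by rewrite /d2 d0 expr0n.
  move: E; rewrite d0 f0 f20 d20 !(mulr0, mul0r, addr0, add0r) => E.
  have : b != 0 by apply: contraTneq hm => a0; rewrite -E a0 mul0r.
  by move=> ?; nia.
Qed.

(** The three sign conditions say that (x, y, z) lies in the half x <= z of the
    kite, a triangle on whose vertices its coordinates are bounded by
    [sum_sq_bound].  The factor 10 is not optimal. *)
Lemma reduced_bounded (s t x y z m : int) :
  -2 <= s -> s < t -> t <= 2 -> 0 < m -> hform s t x y z = - m -> 0 < x ->
  0 <= y - z + (1 - s) * x -> 0 <= (1 + t) * x - y - z -> x <= z ->
  [/\ `|x| <= 10 * m, `|y| <= 10 * m & `|z| <= 10 * m].
Proof.
move=> hs hst ht hm hE hx.
set na := y - _ + _; set nb := _ - z => hna hnb hnc.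
have t4 : 0 <= 4 - t ^+ 2.
  by rewrite (_ : _ - _ = (2 - t) * (2 + t)) ?mulr_ge0 //; clear hE; [lia.. | ring].
have s4 : 0 <= 4 - s ^+ 2.
  by rewrite (_ : _ - _ = (2 - s) * (2 + s)) ?mulr_ge0 //; clear hE; [lia.. | ring].
have k0 : 0 < (2 + t) * (2 - s) by apply: mulr_gt0; clear hE; lia.
have nc0 : 0 <= z - x by rewrite subr_ge0.
have d0 : 0 < t - s by rewrite subr_gt0.
have dm : 0 < (t - s) * m by rewrite mulr_gt0.
have := kite_form s t x y z na nb (z - x) erefl erefl erefl.
rewrite hE mulrNN => /esym E.
have [Ba Bb Bc] := sum_sq_bound _ _ _ _ _ _ _ t4 s4 k0 hna hnb nc0 dm E.
clear E hE t4 s4 k0.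
have Ex : (t - s) * x = na + nb + 2 * (z - x) by rewrite /na /nb; ring.
have Ey : (t - s) * y = t * na + s * nb + (t + s) * (z - x) by rewrite /na /nb; ring.
have le_d (u v : int) : (t - s) * u <= v * ((t - s) * m) -> u <= v * m.
  by rewrite mulrCA ler_pM2l.
have x4 : x <= 4 * m by apply: le_d; rewrite Ex; clear Ex Ey; lia.
have z8 : z - x <= 4 * m by clear Ex Ey le_d; nia.
have bnd (c u k : int) : - k <= c <= k -> 0 <= u <= (t - s) * m -> 
    `|c * u| <= k * ((t - s) * m).
  move=> ck /andP[u0 um]; rewrite normrM (ger0_norm u0).
  by apply: ler_pM => //; rewrite ler_norml.
have B1 : `|t * na| <= 2 * ((t - s) * m) by apply: bnd; [clear Ex Ey; lia|exact/andP].
have B2 : `|s * nb| <= 2 * ((t - s) * m) by apply: bnd; [clear Ex Ey; lia|exact/andP].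
have B3 : `|(t + s) * (z - x)| <= 4 * ((t - s) * m).
  by apply: bnd; [clear Ex Ey; lia|exact/andP].
have y8 : `|y| <= 8 * m.
  rewrite ler_norml lerNl -[- y]mulN1r; apply/andP; split; apply: le_d.
    by rewrite mulN1r mulrN Ey; clear Ex Ey; lia.
  by rewrite Ey; clear Ex Ey; lia.
by clear Ex Ey; split; lia.
Qed.

Lemma mulmx_ext {K : nzRingType} m n (M N : 'M[K]_(m, n)) :
  (forall x : 'cV[K]_n, M *m x = N *m x) -> M = N.
Proof.
move=> MN; apply/matrixP => i j.
have := MN (delta_mx j 0); rewrite -!colE => /matrixP/(_ i 0).
by rewrite !mxE.
Qed.

(** The polynomials are reciprocal up to sign, so reversing the basis conjugates
    A and B to their inverses: this gives the inverses explicitly, and the mirror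
    symmetry x <-> z of the reduction domain. *)
Definition flip {K : nzRingType} : 'M[K]_3 := \matrix_(i, j) (i == rev_ord j)%:R.

Lemma flip_col3 {K : nzRingType} (x y z : K) : flip *m col3 x y z = col3 z y x.
Proof.
apply/matrixP => i j; rewrite !mxE !big_ord_recl big_ord0 !mxE /=.
by case: i => [[|[|[|//]]] lti] /=; rewrite /= ?mul1r ?mul0r ?addr0 ?add0r.
Qed.

Lemma flip_mxA {K : comNzRingType} t : flip *m mxA t *m flip *m mxA t = 1%:M :> 'M[K]_3.
Proof.
apply: mulmx_ext => x; rewrite [x]col3_eta mul1mx -!mulmxA.
rewrite !(mxA_col3, flip_col3); congr col3; ring.
Qed.
Lemma flip_mxB {K : comNzRingType} s : flip *m mxB s *m flip *m mxB s = 1%:M :> 'M[K]_3.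
Proof.
apply: mulmx_ext => x; rewrite [x]col3_eta mul1mx -!mulmxA.
rewrite !(mxB_col3, flip_col3); congr col3; ring.
Qed.
Lemma mxA_unit {K : comUnitRingType} t : (mxA t : 'M[K]_3) \in unitmx.
Proof. by case/mulmx1_unit: (@flip_mxA K t). Qed.
Lemma mxB_unit {K : comUnitRingType} s : (mxB s : 'M[K]_3) \in unitmx.
Proof. by case/mulmx1_unit: (@flip_mxB K s). Qed.
Lemma invmx_left {K : comUnitRingType} n (M N : 'M[K]_n) : M *m N = 1%:M -> invmx N = M.
Proof.
move=> MN; have [_ uN] := mulmx1_unit MN.
by rewrite -[RHS]mulmx1 -(mulmxV uN) mulmxA MN mul1mx.
Qed.
Lemma mxA_inv {K : comUnitRingType} t : invmx (mxA t : 'M[K]_3) = flip *m mxA t *m flip.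
Proof. exact/invmx_left/flip_mxA. Qed.
Lemma mxB_inv {K : comUnitRingType} s : invmx (mxB s : 'M[K]_3) = flip *m mxB s *m flip.
Proof. exact/invmx_left/flip_mxB. Qed.

Definition hgZ (s t : int) : set 'M[int]_3 := gen_group [set mxA t; mxB s].

Definition orthoZ (s t : int) : set 'M[int]_3 :=
  [set g | g \in unitmx /\ forall x, hformZ s t (g *m x) = hformZ s t x].

Lemma finite_bounded_mx m n (N : int) :
  finite_set [set M : 'M[int]_(m, n) | forall i j, `|M i j| <= N].
Proof.
pose f (M : 'M['I_(`|N| + `|N|).+1]_(m, n)) : 'M[int]_(m, n) :=
  map_mx (fun k : 'I_(`|N| + `|N|).+1 => (k : nat)%:Z - `|N|) M.
apply: (@sub_finite_set _ _ (range f)); last first.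
  exact: finite_image.
move=> M HM; exists (map_mx (fun x : int => inord `|(x + `|N|)%R|%N) M) => //.
apply/matrixP => i j; rewrite !mxE.
have := HM i j; move: (M i j) => x hx.
rewrite inordK; lia.
Qed.

Lemma negative_cone_col s t (x : 'cV[int]_3) : -2 <= s -> s < t -> t <= 2 -> 
  hformZ s t x < 0 -> 0 < x 0 0 * x 2%:R 0.
Proof. exact: negative_cone. Qed.

Lemma mxA_orthoZ s t : orthoZ s t (mxA t).
Proof.
split; first exact: mxA_unit.
move=> x; rewrite [x in LHS]col3_eta mxA_col3 /hformZ !mxE /= !intz.
by have := mxA_form s t (x 0 0) (x 1 0) (x 2%:R 0); rewrite !intz.
Qed.
Lemma mxB_orthoZ s t : orthoZ s t (mxB s).
Proof.
split; first exact: mxB_unit.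
move=> x; rewrite [x in LHS]col3_eta mxB_col3 /hformZ !mxE /= !intz.
by have := mxB_form s t (x 0 0) (x 1 0) (x 2%:R 0); rewrite !intz.
Qed.
Lemma orthoZ_mul s t g h : orthoZ s t g -> orthoZ s t h -> orthoZ s t (g *m h).
Proof.
move=> [ug Hg] [uh Hh]; split; first by rewrite unitmx_mul ug.
by move=> x; rewrite -mulmxA Hg.
Qed.
Lemma orthoZ_inv s t g : orthoZ s t g -> orthoZ s t (invmx g).
Proof.
move=> [ug Hg]; split; first by rewrite unitmx_inv.
by move=> x; rewrite -Hg mulmxA mulmxV // mul1mx.
Qed.
Lemma hgZ_ortho s t : hgZ s t `<=` orthoZ s t.
Proof.
move=> g; elim=> {g}.
- by move=> _ [->|->]; [exact: mxA_orthoZ|exact: mxB_orthoZ].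
- by split; [exact: unitmx1 | move=> x; rewrite mul1mx].
- by move=> g h _ Hg _ Hh; exact: orthoZ_mul.
- by move=> g _; exact: orthoZ_inv.
Qed.

Lemma hgZ_gen s t g : g \in [:: mxA t; invmx (mxA t); mxB s; invmx (mxB s)] ->
  hgZ s t g.
Proof.
have HA : hgZ s t (mxA t) by apply: gen_group_in; left.
have HB : hgZ s t (mxB s) by apply: gen_group_in; right.
by rewrite !inE => /or4P[]/eqP->; do ?apply: gen_group_inv.
Qed.

(** By [negative_cone] the signs of the end coordinates are known for x and for
    its four images, so comparing |x + z| amounts to linear inequalities; if none
    of the images is smaller these are the sides of the kite. *)
Lemma descent_step s t (x : 'cV[int]_3) (m : int) :
  -2 <= s -> s < t -> t <= 2 -> 0 < m -> hformZ s t x = - m -> 0 < x 0 0 ->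
  (forall i j, `|x i j| <= 10 * m) \/
  exists2 g, hgZ s t g &
    `|(g *m x) 0 0 + (g *m x) 2%:R 0| < `|x 0 0 + x 2%:R 0|.
Proof.
move=> hs hst ht hm hE hx0.
have hneg : hformZ s t x < 0 by rewrite hE oppr_lt0.
have hx2 : 0 < x 2%:R 0.
  by have := negative_cone_col _ _ _ hs hst ht hneg; rewrite pmulr_rgt0.
case: (pselect (exists2 g, g \in [:: mxA t; invmx (mxA t); mxB s; invmx (mxB s)] &
  `|(g *m x) 0 0 + (g *m x) 2%:R 0| < `|x 0 0 + x 2%:R 0|)) => [[g Hg lt]|Hno].
  by right; exists g => //; exact: hgZ_gen.
left.
have {Hno} Hno g : g \in [:: mxA t; invmx (mxA t); mxB s; invmx (mxB s)] ->
    0 < (g *m x) 0 0 * (g *m x) 2%:R 0 /\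
    `|x 0 0 + x 2%:R 0| <= `|(g *m x) 0 0 + (g *m x) 2%:R 0|.
  move=> Hg; split.
    apply: (negative_cone_col _ _ _ hs hst ht).
    by have [_ ->] := hgZ_ortho _ _ _ (hgZ_gen _ _ _ Hg).
  by rewrite leNgt; apply/negP => lt; apply: Hno; exists g.
have := Hno (mxA t); have := Hno (invmx (mxA t)).
have := Hno (mxB s); have := Hno (invmx (mxB s)) => {Hno}.
rewrite !inE !eqxx ?orbT mxA_inv mxB_inv.
move: hE hneg hx0 hx2; rewrite /hformZ.
move Ea : (x 0 0) => a; move Eb : (x 1 0) => b; move Ec : (x 2%:R 0) => c.
have -> : x = col3 a b c by rewrite [LHS]col3_eta Ea Eb Ec.
rewrite -!mulmxA !(mxA_col3, mxB_col3, flip_col3) !mxE /= !intz.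
move=> hE hneg a0 c0 /(_ isT)[P1 Q1] /(_ isT)[P2 Q2] /(_ isT)[P3 Q3] /(_ isT)[P4 Q4].
suff [? ? ?] : [/\ `|a| <= 10 * m, `|b| <= 10 * m & `|c| <= 10 * m].
  by move=> i j; rewrite mxE; case: i => [[|[|[|//]]] ?].
have [ac|ca] := leP a c.
  apply: (@reduced_bounded s t) => //.
  - have : 0 < b - (s - 1) * a by move: P1; rewrite pmulr_lgt0.
    by move: Q1; lia.
  - have : b - (1 + t) * a < 0.
      by move: P3; rewrite mulrN oppr_gt0 pmulr_llt0.
    by move: Q3; lia.
have [] // := @reduced_bounded s t c b a m hs hst ht hm.
- by rewrite -hE /hform; ring.
- have : 0 < b - (s - 1) * c by move: P2; rewrite pmulr_rgt0.
  by move: Q2; lia.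
- have : b - (1 + t) * c < 0.
    by move: P4; rewrite mulNr oppr_gt0 pmulr_rlt0.
  by move: Q4; lia.
- exact: ltW.
Qed.

(** A bounded entry is insensitive to sign, which is why H need not contain -1. *)
Lemma descent s t (x : 'cV[int]_3) (m : int) :
  -2 <= s -> s < t -> t <= 2 -> 0 < m -> hformZ s t x = - m ->
  exists2 h, hgZ s t h & forall i j, `|(h *m x) i j| <= 10 * m.
Proof.
move=> hs hst ht hm.
have [n] := ubnP `|(x 0 0 + x 2%:R 0)%R|%N.
elim: n => // n IH in x *; rewrite ltnS => len hE.
have [y [Ey y0 E]] : exists y : 'cV[int]_3, [/\ hformZ s t y = - m, 0 < y 0 0 &
    (y = x \/ y = - x)].
  have := negative_cone_col s t x hs hst ht; rewrite hE oppr_lt0 => /(_ hm).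
  have [x0|x0] := ltP 0 (x 0 0); first by exists x; split => //; left.
  move=> xx; exists (- x); split => //; last by right.
    by rewrite -hE /hformZ !mxE /hform; ring.
  rewrite mxE oppr_gt0 lt_neqAle x0 andbT.
  by apply: contraTneq xx => ->; rewrite mul0r.
have {E} [e [Ee Ex]] : exists e : int, `|e| = 1 /\ y = e *: x.
  by case: E => ->; [exists 1; rewrite scale1r|exists (-1); rewrite scaleN1r].
have bnd h : (forall i j, `|(h *m y) i j| <= 10 * m) ->
    forall i j, `|(h *m x) i j| <= 10 * m.
  by move=> H i j; have := H i j; rewrite Ex -scalemxAr mxE normrM Ee mul1r.
have [By|[g Hg lt]] := descent_step s t y m hs hst ht hm Ey y0.
  by exists 1%:M; [exact: gen_group_1|apply: bnd; rewrite mul1mx].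
have [||h Hh Bh] := IH (g *m y).
- have Exy : `|y 0 0 + y 2%:R 0| = `|x 0 0 + x 2%:R 0|.
    by rewrite Ex !mxE -mulrDr normrM Ee mul1r.
  by apply: leq_trans len; rewrite -ltz_nat !abszE -Exy.
- by have [_ ->] := hgZ_ortho _ _ _ Hg.
exists (h *m g); first exact: gen_group_mul.
by apply: bnd => i j; rewrite -mulmxA.
Qed.

Definition polarZ (s t : int) (x y : 'cV[int]_3) : int :=
  hformZ s t (x + y) - hformZ s t x - hformZ s t y.

Lemma orthoZ_polar s t g x y : orthoZ s t g -> polarZ s t (g *m x) (g *m y) = polarZ s t x y.
Proof. by move=> [_ Hg]; rewrite /polarZ -mulmxDr !Hg. Qed.

(** The centre of the Dirichlet domain: its polar is a multiple of x + z, by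
    [polarZ_axis_pt]. *)
Definition axis_pt (s t : int) : 'cV[int]_3 :=
  col3 (4 + t - s) (2 * (t + s)) (4 + t - s).

Lemma hformZ_axis_pt s t : hformZ s t (axis_pt s t) =
  - (4 * (4 + t - s) * ((2 + t) * (2 - s)) * (t - s)).
Proof. rewrite /hformZ /hform !mxE /=; ring. Qed.

Lemma polarZ_axis_pt s t x : polarZ s t (axis_pt s t) x =
  - (4 * ((2 + t) * (2 - s)) * (t - s)) * (x 0 0 + x 2%:R 0).
Proof. rewrite /polarZ /hformZ /hform !mxE /=; ring. Qed.

(** The three squares of [hform_sq] are independent linear functions of a
    column, hence bounding them on all columns leaves finitely many matrices. *)
Lemma finite_bounded_columns (s t K : int) : 1 <= 4 + t - s -> `|t + s| <= 4 ->
  finite_set [set g : 'M[int]_3 | forall j, [/\ (g 0 j - g 2%:R j) ^+ 2 <= K,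
    ((4 + t - s) * g 1 j - (t + s) * (g 0 j + g 2%:R j)) ^+ 2 <= K &
    (g 0 j + g 2%:R j) ^+ 2 <= K]].
Proof.
move=> p0 ts.
apply: (@sub_finite_set _ _ [set g : 'M[int]_3 | forall i j, `|g i j| <= 5 * K]); last first.
  exact: finite_bounded_mx.
move=> g Hg i j.
have -> : g i j = [:: g 0 j; g 1 j; g 2%:R j]`_i.
  by case: i => [[|[|[|//]]] ?] /=; congr (g _ _); apply/val_inj.
case: (Hg j); move: (g 0 j) (g 1 j) (g 2%:R j) => x y z.
have le_abs (u : int) : u ^+ 2 <= K -> `|u| <= K.
  apply: le_trans; rewrite -(real_normK (num_real u)) expr2.
  by have := normr_ge0 u; clear; move: `|u| => v; nia.
move=> /le_abs BX /le_abs BY /le_abs Bl.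
have Bx : `|x| <= 5 * K by clear -BX Bl; lia.
have Bz : `|z| <= 5 * K by clear -BX Bl; lia.
have By : `|y| <= 5 * K.
  have : `|(4 + t - s) * y| <= K + 4 * K.
    rewrite -[_ * y](subrK ((t + s) * (x + z))).
    apply: le_trans (ler_normD _ _) _; apply: lerD => //.
    by rewrite normrM ler_pM.
  rewrite normrM (gtr0_norm (lt_le_trans _ p0)) //.
  have : `|y| <= (4 + t - s) * `|y| by rewrite -[leLHS]mul1r ler_wpM2r.
  by clear; lia.
by case: i => [[|[|[|//]]] li] /=.
Qed.

Lemma hformZ_delta s t (j : 'I_3) : hformZ s t (delta_mx j 0) = 4 + t - s.
Proof.
rewrite /hformZ /hform !mxE !eqxx !andbT.
by case: j => [[|[|[|//]]] lj] /=; ring.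
Qed.

Lemma hformZ_col s t (g : 'M[int]_3) j : orthoZ s t g ->
  hform s t (g 0 j) (g 1 j) (g 2%:R j) = 4 + t - s.
Proof.
by case=> _ Hg; have := Hg (delta_mx j 0); rewrite hformZ_delta -colE /hformZ !mxE.
Qed.

(** An isometry that fixes [axis_pt] preserves x + z, the only coordinate that
    enters the form with a negative sign, so its columns are bounded. *)
Lemma finite_stab s t : -2 <= s -> s < t -> t <= 2 ->
  finite_set [set g | orthoZ s t g /\ g *m axis_pt s t = axis_pt s t].
Proof.
move=> hs hst ht.
set k := (2 + t) * (2 - s).
have k0 : 0 < k by apply: mulr_gt0; lia.
pose K : int := (4 + t - s) ^+ 2 + k * (t - s) + 1.
have p0 : 1 <= 4 + t - s by lia.
apply: sub_finite_set (finite_bounded_columns s t K p0 _); last by lia.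
move=> g [Og Eg] j.
have El : g 0 j + g 2%:R j = (j != 1)%:R.
  have := orthoZ_polar s t g (axis_pt s t) (delta_mx j 0) Og.
  rewrite Eg !polarZ_axis_pt -colE !mxE => /mulfI ->; last first.
    rewrite oppr_eq0 -/k; apply: lt0r_neq0.
    by apply: mulr_gt0; [apply: mulr_gt0 | rewrite subr_gt0].
  by case: j => [[|[|[|//]]] lj].
have := hform_sq s t (g 0 j) (g 1 j) (g 2%:R j).
rewrite (hformZ_col _ _ _ _ Og) El -/k.
move: (g 0 j) (g 1 j) (g 2%:R j) => x y z {El}.
set l := (j != 1)%:R; set X := x - z; set Y := _ * y - _ => E.
have Y0 : 0 <= Y ^+ 2 by exact: sqr_ge0.
have X0 : 0 <= X ^+ 2 by exact: sqr_ge0.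
have l2 : l ^+ 2 <= 1 by rewrite /l; case: (j != 1); rewrite ?expr1n ?expr0n.
have d0 : 0 < t - s by rewrite subr_gt0.
have kl : k * ((t - s) * l ^+ 2) <= k * (t - s).
  by rewrite ler_pM2l // -[leRHS]mulr1 ler_pM2l.
have kX : X ^+ 2 <= k * ((4 + t - s) * X ^+ 2).
  by rewrite mulrA -[leLHS]mul1r ler_wpM2r // -[1]mulr1 ler_pM.
have kd : 0 <= k * (t - s) by apply: mulr_ge0; apply: ltW.
have p2 := sqr_ge0 (4 + t - s).
rewrite /K; move: E; rewrite -expr2 [k * (_ - _)]mulrBr => E.
by clear -E kl X0 Y0 kX kd l2 p2; split; lia.
Qed.

Lemma finite_hgZ s t : -2 < t -> s < 2 -> t < s -> 0 < 4 + t - s ->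
  finite_set (hgZ s t).
Proof.
move=> ht hs hts p0.
set k := (2 + t) * (2 - s).
have k0 : 0 < k by apply: mulr_gt0; lia.
have p1 : 1 <= 4 + t - s by lia.
apply: sub_finite_set (finite_bounded_columns s t ((4 + t - s) ^+ 2) p1 _); last by lia.
move=> g /hgZ_ortho Og j.
have := hform_sq s t (g 0 j) (g 1 j) (g 2%:R j).
rewrite (hformZ_col _ _ _ _ Og) -/k -expr2.
move: (g 0 j) (g 1 j) (g 2%:R j) => x y z.
set l := x + z; set X := x - z; set Y := _ * y - _ => E.
have Y0 : 0 <= Y ^+ 2 by exact: sqr_ge0.
have X0 : 0 <= X ^+ 2 by exact: sqr_ge0.
have l0 : 0 <= l ^+ 2 by exact: sqr_ge0.
have d1 : 1 <= s - t by lia.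
have kl : l ^+ 2 <= k * ((s - t) * l ^+ 2).
  by rewrite mulrA -[leLHS]mul1r ler_wpM2r // -[1]mulr1 ler_pM.
have kX : X ^+ 2 <= k * ((4 + t - s) * X ^+ 2).
  by rewrite mulrA -[leLHS]mul1r ler_wpM2r // -[1]mulr1 ler_pM.
move: E; rewrite -[t - s]opprB mulNr opprK mulrDr => E.
by clear -E kl kX X0 Y0 l0; split; lia.
Qed.

(** For g in O_f(Z), some h in H brings g^-1 v, with v the point [axis_pt], into
    the bounded set; then h g^-1 is one of the finitely many isometries sending v
    to a bounded vector. *)
Lemma orthoZ_cosets s t : -2 <= s -> s < t -> t <= 2 ->
  exists2 T : set 'M[int]_3, finite_set T &
    forall g, orthoZ s t g -> exists h u, [/\ hgZ s t h, T u & g = u *m h].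
Proof.
move=> hs hst ht.
set v := axis_pt s t.
pose m := 4 * (4 + t - s) * ((2 + t) * (2 - s)) * (t - s).
have m0 : 0 < m by rewrite /m !mulr_gt0 //; lia.
pose W : set 'cV[int]_3 := [set w | forall i j, `|w i j| <= 10 * m].
exists [set invmx u | u in \bigcup_(w in W) [set u | orthoZ s t u /\ u *m v = w]].
  apply/finite_image/bigcup_finite; first exact: finite_bounded_mx.
  move=> w _; have [[u0 [Ou0 Eu0]] | no] := pselect (exists u0, orthoZ s t u0 /\ u0 *m v = w).
    apply: (@sub_finite_set _ _ [set u0 *m x | x in [set g | orthoZ s t g /\ g *m v = v]]).
      move=> u [Ou Eu]; exists (invmx u0 *m u); last first.
        by rewrite mulmxA mulmxV ?mul1mx //; case: Ou0.
      split; first by apply: orthoZ_mul => //; exact: orthoZ_inv.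
      by rewrite -mulmxA Eu -Eu0 mulmxA mulVmx ?mul1mx //; case: Ou0.
    by apply/finite_image/finite_stab.
  by rewrite (_ : mkset _ = set0) // -subset0 => u [? ?]; apply: no; exists u.
move=> g Og.
have Ogi := orthoZ_inv _ _ _ Og.
have [|h Hh Bh] := descent s t (invmx g *m v) m hs hst ht m0.
  by have [_ ->] := Ogi; rewrite hformZ_axis_pt.
have Oh := hgZ_ortho _ _ _ Hh.
exists h, (g *m invmx h); split => //.
- exists (h *m invmx g).
    exists (h *m invmx g *m v); first by rewrite /W /= -mulmxA.
    by split => //; exact: orthoZ_mul.
  apply: invmx_left.
  rewrite mulmxA mulmxKV ?mulmxV //; first by case: Og.
  by case: Oh.
- by rewrite mulmxKV //; case: Oh.
Qed.

(** * Transfer from the integers to fields *)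

Definition hgK {K : comUnitRingType} (s t : int) : set 'M[K]_3 :=
  gen_group [set mxA t; mxB s].

Lemma map_mxA {K L : nzRingType} (f : {rmorphism K -> L}) t : map_mx f (mxA t) = mxA t.
Proof.
apply/matrixP => i j; rewrite !mxE !coef_map /=; case: ifP => _.
  by rewrite rmorphN /= rmorph_int.
by rewrite rmorph_nat.
Qed.
Lemma map_mxB {K L : nzRingType} (f : {rmorphism K -> L}) s : map_mx f (mxB s) = mxB s.
Proof.
apply/matrixP => i j; rewrite !mxE !coef_map /=; case: ifP => _.
  by rewrite rmorphN /= rmorph_int.
by rewrite rmorph_nat.
Qed.

Lemma map_invmx_unit {K L : comUnitRingType} (f : {rmorphism K -> L}) n (g : 'M[K]_n) :
  g \in unitmx -> invmx (map_mx f g) = map_mx f (invmx g).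
Proof. by move=> ug; apply: invmx_left; rewrite -map_mxM mulVmx // map_mx1. Qed.

Lemma hgK_int {K : comUnitRingType} (s t : int) :
  hgK s t = [set (map_mx intr g : 'M[K]_3) | g in hgZ s t].
Proof.
apply/seteqP; split=> h.
- elim=> {h}.
  + move=> _ [->|->].
      by exists (mxA t); [apply: gen_group_in; left|rewrite map_mxA].
    by exists (mxB s); [apply: gen_group_in; right|rewrite map_mxB].
  + by exists 1%:M; [exact: gen_group_1|rewrite map_mx1].
  + move=> _ _ _ [g Hg <-] _ [h Hh <-].
    by exists (g *m h); [exact: gen_group_mul|rewrite map_mxM].
  + move=> _ _ [g Hg <-]; exists (invmx g); first exact: gen_group_inv.
    by rewrite map_invmx_unit //; case: (hgZ_ortho _ _ _ Hg).
- case=> g Hg <- {h}; elim: Hg => {g}.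
  + by move=> _ [->|->]; rewrite ?map_mxA ?map_mxB; apply: gen_group_in; [left|right].
  + by rewrite map_mx1; exact: gen_group_1.
  + by move=> g h _ Hg _ Hh; rewrite map_mxM; exact: gen_group_mul.
  + move=> g Hg Hh; rewrite -map_invmx_unit; first exact: gen_group_inv.
    by case: (hgZ_ortho _ _ _ Hg).
Qed.

Lemma hgK_preserves {K : fieldType} s t (h : 'M[K]_3) :
  hgK s t h -> preserves (gram s t) h.
Proof.
suff: hgK s t h -> h \in unitmx /\ preserves (gram s t) h by move=> H /H[].
elim=> {h}.
- move=> _ [->|->]; (split; first by rewrite (mxA_unit, mxB_unit)) => x.
    by rewrite [x]col3_eta mxA_col3 !qform_gram mxA_form.
  by rewrite [x]col3_eta mxB_col3 !qform_gram mxB_form.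
- by split; [exact: unitmx1|move=> x; rewrite mul1mx].
- move=> g h _ [ug Hg] _ [uh Hh]; split; first by rewrite unitmx_mul ug.
  by move=> x; rewrite -mulmxA Hg.
- move=> g _ [ug Hg]; split; first by rewrite unitmx_inv.
  by move=> x; rewrite -Hg mulmxA mulmxV // mul1mx.
Qed.

Lemma tr_gram s t : (gram s t)^T = gram s t.
Proof. by apply/matrixP => i j; rewrite !mxE distnC. Qed.

(** The values of the form on the orthogonal basis (1, 0, -1), (0, 1, 0),
    [axis_pt] given by the columns of [gram_basis]. *)
Definition gram_diag (s t : int) : 'rV[rat]_3 :=
  \row_i ([:: 4 * ((2 + t) * (2 - s)); 4 + t - s;
     - (4 * (4 + t - s) * ((2 + t) * (2 - s)) * (t - s))]`_i)%:~R.

Definition gram_basis (s t : int) : 'M[rat]_3 :=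
  \matrix_(i, j) ((nth [::] [:: [:: 1; 0; 4 + t - s]; [:: 0; 1; 2 * (t + s)];
     [:: -1; 0; 4 + t - s]] i)`_j)%:~R.

Lemma gram_diagonalized s t :
  (gram_basis s t)^T *m gram s t *m gram_basis s t = diag_mx (gram_diag s t).
Proof.
apply/matrixP => i j; rewrite !mxE !big_ord_recl !big_ord0 !mxE !big_ord_recl !big_ord0 !mxE.
by case: i => [[|[|[|//]]] ?]; case: j => [[|[|[|//]]] ?] /=;
  rewrite ?mulr1n ?mulr0n !(rmorphD, rmorphB, rmorphM, rmorphN) /=; ring.
Qed.

Lemma det_gram_neq0 s t : 2 + t != 0 -> 2 - s != 0 -> 4 + t - s != 0 -> t - s != 0 ->
  \det (gram_basis s t) != 0 /\ \det (gram s t) != 0.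
Proof.
move=> h1 h2 h3 h4.
have := congr1 determinant (gram_diagonalized s t).
rewrite !det_mulmx det_tr det_diag !big_ord_recl big_ord0 !mxE /= => E.
suff : \det (gram_basis s t) * \det (gram s t) * \det (gram_basis s t) != 0.
  by rewrite !mulf_eq0 !negb_or => /andP[/andP[-> ->]].
by rewrite E !mulf_neq0 ?oner_eq0 // intr_eq0 ?oppr_eq0 ?mulf_neq0.
Qed.

Lemma gram_signature s t : -2 <= s -> s < t -> t <= 2 -> has_signature (gram s t) 2 1.
Proof.
move=> hs hst ht.
have k0 : 0 < (2 + t) * (2 - s) by apply: mulr_gt0; lia.
exists (gram_basis s t), (gram_diag s t); split.
- rewrite unitmxE unitfE; apply: (proj1 (det_gram_neq0 _ _ _ _ _ _)); lia.
- exact: gram_diagonalized.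
- rewrite (_ : [set _ | _]%SET = [set 0; 1]%SET) ?cards2 //.
  apply/setP => i; rewrite !inE mxE ltr0z.
  case: i => [[|[|[|//]]] li]; rewrite -!val_eqE /=.
  + by rewrite mulr_gt0.
  + by lia.
  + by rewrite oppr_gt0 ltNge ltW // !mulr_gt0 //; lia.
- rewrite (_ : [set _ | _]%SET = [set 2%:R]%SET) ?cards1 //.
  apply/setP => i; rewrite !inE mxE ltrz0.
  case: i => [[|[|[|//]]] li]; rewrite -!val_eqE /=.
  + by rewrite ltNge ltW // mulr_gt0.
  + by lia.
  + by rewrite oppr_lt0 !mulr_gt0 //; lia.
Qed.

Lemma hgK_hyperbolic {K : fieldType} s t : -2 <= s -> s < t -> t <= 2 ->
  hyperbolic_form (hgK s t : set 'M[K]_3) (gram s t).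
Proof.
move=> hs hst ht; split.
- exact: tr_gram.
- by apply: (proj2 (det_gram_neq0 _ _ _ _ _ _)); lia.
- exact: gram_signature.
- by move=> h; exact: hgK_preserves.
Qed.

(** Polarization turns invariance of the quadratic form into a matrix identity. *)
Lemma preserves_congr {K : numFieldType} n (G : 'M[rat]_n) (g : 'M[K]_n) :
  G^T = G -> preserves G g -> g^T *m map_mx ratr G *m g = map_mx ratr G.
Proof.
move=> GT Hg; apply/eqP; rewrite -subr_eq0; apply/eqP.
set M := _ - _.
have MT : M^T = M by rewrite /M linearB /= !trmx_mul trmxK map_trmx GT mulmxA.
pose b (x y : 'cV[K]_n) := \tr (x^T *m M *m y).
have b0 x : b x x = 0.
  rewrite /b /M mulmxBr mulmxBl linearB /= !trace_mx11; apply/eqP; rewrite subr_eq0.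
  by have := Hg x; rewrite /qform trmx_mul !mulmxA => ->.
clearbody M.
have bC x y : b x y = b y x.
  by rewrite /b -[RHS]mxtrace_tr !trmx_mul trmxK MT mulmxA.
have bxy x y : b x y = 0.
  have : b (x + y) (x + y) = b x x + b y y + (b x y + b y x).
    have trD : (x + y)^T = x^T + y^T by exact: linearD.
    by rewrite /b trD !(mulmxDl, mulmxDr) !mxtraceD; ring.
  rewrite !b0 -(bC x y) !add0r => /esym/eqP.
  by rewrite -mulr2n mulrn_eq0 => /eqP.
apply/matrixP => i j; have := bxy (delta_mx i 0) (delta_mx j 0).
by rewrite /b trmx_delta -rowE -colE trace_mx11 !mxE.
Qed.

(** Five entries of the identities A^T G A = G and B^T G B = G already force G to
    be Toeplitz and to satisfy the two equations that define [hform]. *)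
Lemma gram_unique {K : numFieldType} (s t : int) (G : 'M[rat]_3) : 4 + t - s != 0 ->
  G^T = G -> (forall h : 'M[K]_3, hgK s t h -> preserves G h) ->
  exists c, G = c *: gram s t.
Proof.
move=> p0 GT HG.
have EA : (mxA t)^T *m G *m mxA t = G.
  apply: (map_mx_inj (f := @ratr K)).
  rewrite !map_mxM -map_trmx map_mxA; apply: preserves_congr => //.
  by apply: HG; apply: gen_group_in; left.
have EB : (mxB s)^T *m G *m mxB s = G.
  apply: (map_mx_inj (f := @ratr K)).
  rewrite !map_mxM -map_trmx map_mxB; apply: preserves_congr => //.
  by apply: HG; apply: gen_group_in; right.
have Gs i j : G i j = G j i by rewrite -[in LHS]GT mxE.
have ea i j : G i j = ((mxA t)^T *m G *m mxA t) i j by rewrite EA.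
have eb i j : G i j = ((mxB s)^T *m G *m mxB s) i j by rewrite EB.
have o0 : lift ord0 ord0 = 1 :> 'I_3 by exact/val_inj.
have o1 : lift ord0 (lift ord0 ord0) = 2%:R :> 'I_3 by exact/val_inj.
move: (ea 0 0) (ea 1 1) (ea 0 1) (ea 1 2%:R) (eb 1 2%:R).
rewrite !mxE !big_ord_recl !big_ord0 !mxE !big_ord_recl !big_ord0 !mxE /=.
rewrite !coef_map !poly_plus_coef !poly_minus_coef /= ?o1 ?o0.
rewrite (Gs 1 0) (Gs 2%:R 0) (Gs 2%:R 1).
have -> : ord0 = 0 :> 'I_3 by exact/val_inj.
rewrite !(mul0r, mul1r, mulr0, mulr1, addr0, add0r) !(rmorphB, rmorphD, rmorphN) /=.
move Ep : (G 0 0) => p; move Eq : (G 0 1) => q; move Er : (G 0 2%:R) => r.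
move=> E11 E22 E12 e1 e2.
have p0' : 4 + t%:~R - s%:~R != 0 :> rat.
  by move: p0; rewrite -(intr_eq0 rat) rmorphB rmorphD.
have Eq' : (4 + t%:~R - s%:~R) * q = - (t%:~R + s%:~R) * p.
  by move: e1 e2; rewrite -E12 -E22 -E11 => e1 e2; lra.
have Er' : r = (2 - s%:~R) * q + (s%:~R - 1) * p.
  by move: e2; rewrite -E12 -E22 -E11 => e2; lra.
exists (p / (4 + t%:~R - s%:~R)).
have Hq : q = p / (4 + t%:~R - s%:~R) * (- (t%:~R + s%:~R)).
  by apply: (mulfI p0'); rewrite Eq'; field.
have Hr : r = p / (4 + t%:~R - s%:~R) * (3 * s%:~R - 3 * t%:~R + 2 * (t%:~R * s%:~R) - 4).
  by rewrite Er' Hq; field.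
have Hp : p = p / (4 + t%:~R - s%:~R) * (4 + t%:~R - s%:~R) by rewrite divfK.
apply/matrixP => i j; rewrite !mxE.
have -> : G i j = [:: p; q; r]`_(`|(i : nat)%:Z - (j : nat)%:Z|%N).
  have k0 (lt : (0 < 3)%N) : Ordinal lt = 0 by exact/val_inj.
  have k1 (lt : (1 < 3)%N) : Ordinal lt = 1 by exact/val_inj.
  have k2 (lt : (2 < 3)%N) : Ordinal lt = 2%:R by exact/val_inj.
  case: i => [[|[|[|//]]] li]; case: j => [[|[|[|//]]] lj] /=;
    rewrite ?k0 ?k1 ?k2 ?(Gs 1 0) ?(Gs 2%:R 0) ?(Gs 2%:R 1);
    by rewrite -?E12 -?E22 -?E11 ?Ep ?Eq ?Er.
case: `|_ - _|%N => [|[|[|n]]] /=; rewrite ?(rmorphB, rmorphD, rmorphM, rmorphN) /=.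
- exact: Hp.
- exact: Hq.
- exact: Hr.
- by rewrite !nth_nil mulr0z mulr0.
Qed.

Lemma hgK_finite {K : comUnitRingType} (s t : int) : -2 < t -> s < 2 -> t < s -> 0 < 4 + t - s ->
  finite_set (hgK s t : set 'M[K]_3).
Proof. by move=> *; rewrite hgK_int; apply/finite_image/finite_hgZ. Qed.

Lemma hform_pos {K : realFieldType} (s t x y z : K) :
  -2 < t -> s < 2 -> t < s -> 0 < 4 + t - s -> col3 x y z != 0 -> 0 < hform s t x y z.
Proof.
move=> ht hs ts p0 /eqP nz.
rewrite -(pmulr_rgt0 _ p0) hform_sq.
have k0 : 0 < (2 + t) * (2 - s) by apply: mulr_gt0; lra.
set Y := _ - _ * (x + z).
have -> : (4 + t - s) * (x - z) ^+ 2 - (t - s) * (x + z) ^+ 2 =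
  (4 + t - s) * (x - z) ^+ 2 + (s - t) * (x + z) ^+ 2 by ring.
have d0 : 0 < s - t by rewrite subr_gt0.
have a0 : 0 <= (4 + t - s) * (x - z) ^+ 2 by rewrite mulr_ge0 ?sqr_ge0 ?ltW.
have b0 : 0 <= (s - t) * (x + z) ^+ 2 by rewrite mulr_ge0 ?sqr_ge0 ?ltW.
have c0 : 0 <= (2 + t) * (2 - s) * ((4 + t - s) * (x - z) ^+ 2 + (s - t) * (x + z) ^+ 2).
  by apply: mulr_ge0; [exact: ltW|exact: addr_ge0].
rewrite lt_def addr_ge0 ?sqr_ge0 // andbT paddr_eq0 ?sqr_ge0 // mulf_eq0 gt_eqF //=.
rewrite paddr_eq0 // !mulf_eq0 !(gt_eqF p0) !(gt_eqF d0) /= !orbb.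
apply/negP => /andP[/andP[/eqP E1 /eqP E2] /eqP E3]; apply: nz.
have x0 : x = 0 by lra.
have z0 : z = 0 by lra.
have y0 : y = 0.
  move: E3; rewrite /Y E2 mulr0 subr0 => /eqP; rewrite mulf_eq0 (gt_eqF p0) /=.
  by move/eqP.
rewrite x0 y0 z0; apply/matrixP => i j; rewrite !mxE.
by case: i => [[|[|[|//]]] li].
Qed.

(** Each entry of a diagonalization of c f is c times a value of f at a nonzero
    vector, so all entries have the sign of c. *)
Lemma definite_no_signature (s t : int) (c : rat) :
  -2 < t -> s < 2 -> t < s -> 0 < 4 + t - s -> ~ has_signature (c *: gram s t) 2 1.
Proof.
move=> ht hs ts p0 [S [d [uS ES c2 c1]]].
have pos j : exists2 u, 0 < u & d 0 j = c * u.
  exists (qform (gram s t) (col j S)).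
    rewrite [col j S]col3_eta qform_gram; apply: hform_pos.
    - by rewrite -[-2]/((-2)%:~R) ltr_int.
    - by rewrite -[2]/(2%:~R) ltr_int.
    - by rewrite ltr_int.
    - by move: p0; rewrite -(ltr0z rat) rmorphB rmorphD.
    rewrite -col3_eta; apply: contraTneq uS => E; rewrite unitmxE unitfE negbK.
    rewrite -det_tr (expand_det_row _ j) big1 // => k _.
    by have /matrixP/(_ k 0) := E; rewrite !mxE => ->; rewrite mul0r.
  have -> : d 0 j = diag_mx d j j by rewrite mxE eqxx mulr1n.
  rewrite -ES -scalemxAr -scalemxAl mxE /qform; congr (_ * _).
  have -> : map_mx ratr (gram s t) = gram s t.
    by apply/matrixP => ? ?; rewrite !mxE ratr_int.
  by rewrite tr_col -row_mul colE mulmxA -row_mul -colE [RHS]mxE [RHS]mxE.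
have [cp|cp] := ltP 0 c.
  move: c1; rewrite (_ : [set _ | _]%SET = finset.set0) ?cards0 //.
  apply/setP => j; rewrite !inE; have [u u0 ->] := pos j.
  by rewrite ltNge ltW // mulr_gt0.
move: c2; rewrite (_ : [set _ | _]%SET = finset.set0) ?cards0 //.
apply/setP => j; rewrite !inE; have [u u0 ->] := pos j.
by rewrite ltNge mulr_le0_ge0 // ltW.
Qed.

(** * Angles and polynomials *)

Lemma e2piD (R : realType) a b : e2pi R (a + b) = e2pi R a * e2pi R b.
Proof.
rewrite /e2pi rmorphD mulrDr cosD sinD /=; congr Complex; ring.
Qed.

Lemma e2pi0 (R : realType) : e2pi R 0 = 1.
Proof. by rewrite /e2pi rmorph0 mulr0 cos0 sin0. Qed.

Lemma e2pi1 (R : realType) : e2pi R 1 = 1.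
Proof. by rewrite /e2pi rmorph1 mulr1 mulr_natl cos2pi sin2pi. Qed.

Lemma e2piX (R : realType) a n : e2pi R (a *+ n) = e2pi R a ^+ n.
Proof. by elim: n => [|n IH]; rewrite ?e2pi0 // mulrS exprS e2piD IH. Qed.

Lemma e2piN (R : realType) a : e2pi R (- a) = conjc (e2pi R a).
Proof. by rewrite /e2pi rmorphN mulrN cosN sinN. Qed.

Lemma e2pi_conj (R : realType) a : e2pi R a * conjc (e2pi R a) = 1.
Proof. by rewrite -e2piN -e2piD subrr e2pi0. Qed.

Lemma e2pi_int (R : realType) (m : int) : e2pi R m%:~R = 1.
Proof.
have nat1 (n : nat) : e2pi R n%:R = 1 by rewrite e2piX e2pi1 expr1n.
case: m => n; first exact: nat1.
by rewrite NegzE rmorphN /= e2piN -[_%:~R]/(n.+1%:R) nat1 rmorph1.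
Qed.

Lemma e2pi_shift (R : realType) d a : e2pi R (shift1 d a) = e2pi R d * e2pi R a.
Proof.
rewrite /shift1 -rmorphN /=.
by rewrite e2piD e2pi_int mulr1 e2piD mulrC.
Qed.

(** From cos (2 u) = 1 one gets sin u = 0, while 0 < u < pi for 0 < a < 1, u = pi a. *)
Lemma e2pi_eq1 (R : realType) a : 0 <= a < 1 -> e2pi R a = 1 -> a = 0.
Proof.
move=> /andP[a0 a1] [Ec _]; apply/eqP; rewrite eq_le a0 andbT leNgt.
apply/negP => {}a0.
have := sin2cos2 (pi * ratr a : R).
have := cos_mulr2n (pi * ratr a : R).
have -> : (pi * ratr a) *+ 2 = 2 * pi * ratr a :> R by ring.
rewrite Ec.
have sgt : 0 < sin (pi * ratr a : R).
  apply: sin_gt0_pi; rewrite mulr_gt0 ?pi_gt0 ?ltr0q //=.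
  by rewrite -[ltRHS]mulr1 ltr_pM2l ?pi_gt0 // -(rmorph1 (@ratr R)) ltr_rat.
move=> E1 E2.
have : 0 < sin (pi * ratr a : R) ^+ 2 by rewrite exprn_gt0.
by rewrite E2; move: E1; rewrite -mulr_natl; lra.
Qed.

Lemma e2pi_inj (R : realType) a b : 0 <= a < 1 -> 0 <= b < 1 ->
  e2pi R a = e2pi R b -> a = b.
Proof.
wlog ab : a b / a <= b => [hw|].
  by have [/hw|/ltW/hw h ? ? ?] := leP a b => //; apply/esym/h.
move=> /andP[a0 a1] /andP[b0 b1] E; apply/eqP; rewrite eq_sym -subr_eq0.
apply/eqP/(@e2pi_eq1 R); first by apply/andP; split; lra.
by rewrite e2piD e2piN -E e2pi_conj.
Qed.

Lemma exp_poly_root (R : realType) n (alpha : n.-tuple rat) (z : R[i]) :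
  root (exp_poly R alpha) z -> exists i, z = e2pi R (tnth alpha i).
Proof.
rewrite /exp_poly -(big_map (e2pi R) xpredT (fun x => 'X - x%:P)) root_prod_XsubC.
by case/mapP => a /tnthP[i ->] ->; exists i.
Qed.

(** As e2pi is injective on [0, 1), each linear factor on the left occurs on the
    right with the same angle and can be cancelled. *)
Lemma exp_poly_perm (R : realType) (s1 s2 : seq rat) :
  all (fun a => 0 <= a < 1) s1 -> all (fun a => 0 <= a < 1) s2 ->
  \prod_(a <- s1) ('X - (e2pi R a)%:P) = \prod_(a <- s2) ('X - (e2pi R a)%:P) ->
  perm_eq s1 s2.
Proof.
elim: s1 s2 => [|a s1 IH] s2 /=.
  move=> _ _; rewrite big_nil; case: s2 => // b s2 /(congr1 (fun p : {poly R[i]} => root p (e2pi R b))).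
  rewrite (negPf (root1 _)) -(big_map (e2pi R) xpredT (fun x => 'X - x%:P)) root_prod_XsubC.
  by rewrite map_f ?mem_head.
move=> /andP[ha h1] h2 E.
have a2 : a \in s2.
  have : root (\prod_(b <- s2) ('X - (e2pi R b)%:P)) (e2pi R a).
    by rewrite -E big_cons rootM root_XsubC eqxx.
  rewrite -(big_map (e2pi R) xpredT (fun x => 'X - x%:P)) root_prod_XsubC.
  case/mapP => b b2 /e2pi_inj -> //; exact: (allP h2).
have p2 := perm_to_rem a2.
rewrite perm_sym (perm_trans p2) // perm_cons perm_sym; apply: IH => //.
  by apply/allP => b /mem_rem; apply: (allP h2).
move: E; rewrite big_cons (perm_big _ p2) big_cons => /mulfI; apply.
by rewrite polyXsubC_eq0.
Qed.

Lemma prod_XsubC3 (K : comNzRingType) (x y z : K) :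
  ('X - x%:P) * ('X - y%:P) * ('X - z%:P) =
  Poly [:: - (x * y * z); x * y + y * z + z * x; - (x + y + z); 1].
Proof.
rewrite /= !cons_poly_def !(polyCN, polyCD, polyCM) polyC1 polyC0; ring.
Qed.

Lemma map_poly_plus (K : nzRingType) (t : int) :
  map_poly intr (poly_plus t) = Poly [:: 1; 1 + t%:~R; 1 + t%:~R; 1] :> {poly K}.
Proof.
apply/polyP => i; rewrite coef_map !coef_Poly.
by case: i => [|[|[|[|i]]]] //=; rewrite ?intrD // !nth_nil mulr0z.
Qed.
Lemma map_poly_minus (K : nzRingType) (s : int) :
  map_poly intr (poly_minus s) = Poly [:: -1; 1 - s%:~R; s%:~R - 1; 1] :> {poly K}.
Proof.
apply/polyP => i; rewrite coef_map !coef_Poly.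
by case: i => [|[|[|[|i]]]] //=; rewrite ?intrB ?mulrN1z // !nth_nil mulr0z.
Qed.

Lemma horner_plus (K : comNzRingType) t (z : K) :
  (map_poly intr (poly_plus t)).[z] = (z + 1) * (z ^+ 2 + t%:~R * z + 1).
Proof. by rewrite map_poly_plus horner_Poly /=; ring. Qed.
Lemma horner_minus (K : comNzRingType) s (z : K) :
  (map_poly intr (poly_minus s)).[z] = (z - 1) * (z ^+ 2 + s%:~R * z + 1).
Proof. by rewrite map_poly_minus horner_Poly /=; ring. Qed.

Definition is_plus (R : realType) (t : int) (alpha : 3.-tuple rat) :=
  exp_poly R alpha = map_poly intr (poly_plus t).
Definition is_minus (R : realType) (s : int) (alpha : 3.-tuple rat) :=
  exp_poly R alpha = map_poly intr (poly_minus s).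

(** The real part of the left-hand side is a sum of two cosines. *)
Lemma e2pi_sum2_bound (R : realType) a b (t : int) :
  e2pi R a + e2pi R b = t%:~R -> `|t| <= 2.
Proof.
move=> /(congr1 (@complex.Re R)).
have -> : complex.Re (t%:~R : R[i]) = t%:~R.
  by rewrite -(rmorph_int (real_complex R)).
rewrite /= => E.
have := cos_geN1 (2 * pi * ratr a : R); have := cos_geN1 (2 * pi * ratr b : R).
have := cos_le1 (2 * pi * ratr a : R); have := cos_le1 (2 * pi * ratr b : R).
move=> h1 h2 h3 h4.
rewrite -(ler_int R) intr_norm ler_norml -E; apply/andP; split; lra.
Qed.

Lemma tuple3P (T : Type) (u : 3.-tuple T) : exists a b c, u = [tuple a; b; c].
Proof.
case: u => [[|a [|b [|c [|]]]] //= sz]; exists a, b, c; exact/val_inj.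
Qed.

Lemma exp_poly3 (R : realType) a b c (x := e2pi R a) (y := e2pi R b) (z := e2pi R c) :
  exp_poly R [tuple a; b; c] = Poly [:: - (x * y * z); x * y + y * z + z * x; - (x + y + z); 1].
Proof. by rewrite -prod_XsubC3 /exp_poly !big_cons big_nil mulr1 mulrA. Qed.

(** Let e1, e2, e3 be the elementary symmetric functions of the roots x, y, z.
    As conjugation inverts the roots, e3^2 = e3 conj(e3) = 1 and e2 = e3 conj(e1)
    = e3 e1, so the polynomial is X^3 + uX^2 + uX + 1 or X^3 + uX^2 - uX - 1 with
    u = - e1.  One root is then -1 or 1, and the other two have an integral sum,
    of modulus at most 2. *)
Lemma cyclotomic_cases (R : realType) (alpha : 3.-tuple rat) :
  cyclotomic_product (exp_poly R alpha) ->
  (exists2 t : int, `|t| <= 2 & is_plus R t alpha) \/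
  (exists2 s : int, `|s| <= 2 & is_minus R s alpha).
Proof.
have [a [b [c ->]]] := tuple3P _ alpha.
rewrite /is_plus /is_minus exp_poly3.
have bnd a' b' (u : int) : e2pi R a' + e2pi R b' = (- u)%:~R -> `|u| <= 2.
  by move/e2pi_sum2_bound; rewrite normrN.
have hx := e2pi_conj R a; have hy := e2pi_conj R b; have hz := e2pi_conj R c.
have := (bnd a b, bnd b c, bnd a c).
move: (e2pi R a) (e2pi R b) (e2pi R c) hx hy hz => x y z hx hy hz {bnd} bnd.
case=> sq _; move: (\prod_(k <- sq) _) => q E.
have e0 : - (x * y * z) = (q`_0)%:~R by rewrite -coef_map -E coef_Poly.
have e1 : x * y + y * z + z * x = (q`_1)%:~R by rewrite -coef_map -E coef_Poly.
have e2 : - (x + y + z) = (q`_2)%:~R by rewrite -coef_map -E coef_Poly.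
have c0 := congr1 conjc e0; have c2 := congr1 conjc e2.
move: c0 c2; rewrite !rmorph_int rmorphN !rmorphM rmorphN !rmorphD /=.
move: (conjc x) (conjc y) (conjc z) hx hy hz => x' y' z' hx hy hz c0 c2.
have sq1 : q`_0 * q`_0 = 1.
  apply: (@intr_inj R[i]); rewrite rmorphM /= -{1}e0 -c0.
  transitivity ((x * x') * (y * y') * (z * z')); first by ring.
  by rewrite hx hy hz !mulr1.
have e12 : (q`_1)%:~R = (q`_0)%:~R * (q`_2)%:~R :> R[i].
  rewrite -e1 -e0 -c2.
  transitivity (x * y * (z * z') + (x * x') * (y * z) + (y * y') * (z * x)); last by ring.
  by rewrite hx hy hz; ring.
have ex : - x - y - z = (q`_2)%:~R by rewrite -e2; ring.
have : q`_0 == 1 \/ q`_0 == -1.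
  by apply/orP; rewrite -eqf_sqr expr1n expr2 sq1.
case=> /eqP q0; [left; exists (q`_2 - 1) | right; exists (q`_2 + 1)].
- have : (1 + x) * (1 + y) * (1 + z) == 0.
    have -> : (1 + x) * (1 + y) * (1 + z) = 1 - (- (x + y + z)) + (x * y + y * z + z * x)
       - (- (x * y * z)) by ring.
    by rewrite e0 e1 e2 e12 q0; apply/eqP; ring.
  case: bnd => [[b1 b2] b3].
  rewrite !mulf_eq0 -orbA => /or3P[] /eqP h; [apply: b2|apply: b3|apply: b1];
    rewrite opprB rmorphB /= -ex.
  + by have -> : x = -1 by [rewrite -[x](addKr 1) h addr0]; ring.
  + by have -> : y = -1 by [rewrite -[y](addKr 1) h addr0]; ring.
  + by have -> : z = -1 by [rewrite -[z](addKr 1) h addr0]; ring.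
- by rewrite map_poly_plus e0 e1 e2 e12 q0 mul1r rmorphB /= addrCA subrr addr0.
- have : (1 - x) * (1 - y) * (1 - z) == 0.
    have -> : (1 - x) * (1 - y) * (1 - z) = 1 + (- (x + y + z)) + (x * y + y * z + z * x)
       + (- (x * y * z)) by ring.
    by rewrite e0 e1 e2 e12 q0; apply/eqP; ring.
  case: bnd => [[b1 b2] b3].
  rewrite !mulf_eq0 !subr_eq0 -orbA => /or3P[] /eqP h; [apply: b2|apply: b3|apply: b1];
    rewrite rmorphN rmorphD /= -ex -h; ring.
- rewrite map_poly_minus e0 e1 e2 e12 q0 rmorphN1 mulN1r rmorphD /= addrK.
  by congr (Poly [:: _; _; _; _]); ring.
Qed.

Lemma quadratic_root (K : closedFieldType) (u : K) : exists z : K, z ^+ 2 + u * z + 1 = 0.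
Proof.
have [z Ez] := solve_monicpoly (fun i => - [:: 1; u]`_i) (ltn0Sn 1).
exists z; rewrite Ez !big_ord_recl big_ord0 /=; ring.
Qed.

(** Two polynomials of the same family share the root -1 or 1; P_t and Q_s share
    the roots of X^2 + tX + 1 if s = t, and a root 1 or -1 if t = -2 or s = 2. *)
Lemma hg_classify (R : realType) (alpha beta : 3.-tuple rat) :
  hg_data R alpha beta ->
  exists s t : int, [/\ -2 <= s <= 1, -1 <= t <= 2, s != t &
    (is_plus R t alpha /\ is_minus R s beta) \/ (is_plus R t beta /\ is_minus R s alpha)].
Proof.
case=> [[/allP ra /allP rb]] ab ca cb.
have no_common z : (exp_poly R alpha).[z] = 0 -> (exp_poly R beta).[z] = 0 -> False.
  move=> /rootP/exp_poly_root [i ->] /rootP/exp_poly_root [j /e2pi_inj E].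
  by have := ab i j; rewrite E ?eqxx //; [apply: ra|apply: rb]; exact: mem_tnth.
have at1 (u : R[i]) : u = 1 -> u - 1 = 0 by move->; rewrite subrr.
have range (p1 p2 : {poly R[i]}) (s t : int) : p1 = map_poly intr (poly_plus t) ->
    p2 = map_poly intr (poly_minus s) -> (forall z, p1.[z] = 0 -> p2.[z] = 0 -> False) ->
    `|t| <= 2 -> `|s| <= 2 -> [/\ -2 <= s <= 1, -1 <= t <= 2 & s != t].
  move=> -> -> nc ht hs.
  have s2 : s != 2.
    apply/eqP => s2; apply: (nc (-1)); rewrite ?horner_plus ?horner_minus ?s2; ring.
  have t2 : t != -2.
    apply/eqP => t2; apply: (nc 1); rewrite ?horner_plus ?horner_minus ?t2; ring.
  have st : s != t.
    apply/eqP => st; have [z Ez] := quadratic_root _ (t%:~R : R[i]).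
    by apply: (nc z); rewrite ?horner_plus ?horner_minus ?st Ez mulr0.
  by split=> //; lia.
case: (cyclotomic_cases _ _ ca) => [[t ht Et]|[s hs Es]];
  case: (cyclotomic_cases _ _ cb) => [[t' ht' Et']|[s' hs' Es']].
- by case: (no_common (-1)); rewrite (Et, Et') horner_plus; ring.
- have [h1 h2 h3] := range _ _ _ _ Et Es' no_common ht hs'.
  by exists s', t; split=> //; left.
- have [|h1 h2 h3] := range _ _ _ _ Et' Es _ ht' hs.
    by move=> z h h'; apply: (no_common z).
  by exists s, t'; split=> //; right.
- by case: (no_common 1); rewrite (Es, Es') horner_minus; ring.
Qed.

Lemma hg_group_hgK (R : realType) s t alpha beta :
  is_plus R t alpha -> is_minus R s beta -> hg_group R alpha beta = hgK s t.
Proof. by rewrite /hg_group /is_plus /is_minus => -> ->. Qed.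

Lemma hg_groupC (R : realType) n (alpha beta : n.-tuple rat) :
  hg_group R alpha beta = hg_group R beta alpha.
Proof. by rewrite /hg_group setUC. Qed.

(** The angles of P_t; the last alternative is t = -1. *)
Definition angles_plus (t : int) : 3.-tuple rat :=
  if t == 2 then [tuple 1/2; 1/2; 1/2] else if t == 1 then [tuple 1/3; 1/2; 2/3]
  else if t == 0 then [tuple 1/4; 1/2; 3/4] else [tuple 1/6; 1/2; 5/6].
(** The angles of Q_s; the last alternative is s = 1. *)
Definition angles_minus (s : int) : 3.-tuple rat :=
  if s == -2 then [tuple 0; 0; 0] else if s == -1 then [tuple 0; 1/6; 5/6]
  else if s == 0 then [tuple 0; 1/4; 3/4] else [tuple 0; 1/3; 2/3].

Lemma e2pi_neq (R : realType) (a b : rat) : 0 <= a < 1 -> 0 <= b < 1 -> a != b ->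
  e2pi R a != e2pi R b.
Proof. by move=> ha hb; apply: contra_neq; exact: e2pi_inj. Qed.

Lemma e2pi_half (R : realType) : e2pi R (1/2) = -1.
Proof.
have : e2pi R (1/2) ^+ 2 == 1 by rewrite -e2piX -(e2pi1 R) (_ : 1/2 *+ 2 = 1 :> rat).
rewrite sqrf_eq1 => /orP[|/eqP //].
by rewrite -(e2pi0 R) (negPf (e2pi_neq _ _ _ _ _ _)).
Qed.

Lemma e2pi_third (R : realType) : e2pi R (1/3) ^+ 2 + e2pi R (1/3) + 1 = 0.
Proof.
have E : e2pi R (1/3) ^+ 3 = 1 by rewrite -e2piX -(e2pi1 R) (_ : 1/3 *+ 3 = 1 :> rat).
have : e2pi R (1/3) != 1 by rewrite -(e2pi0 R) e2pi_neq.
rewrite -subr_eq0 => /mulfI; apply.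
by rewrite mulr0 -[RHS](subrr 1) -{3}E; ring.
Qed.

Lemma e2pi_quarter (R : realType) : e2pi R (1/4) ^+ 2 = -1.
Proof. by rewrite -e2piX -(e2pi_half R) (_ : 1/4 *+ 2 = 1/2 :> rat). Qed.

Lemma e2pi_sixth (R : realType) : e2pi R (1/6) ^+ 2 = e2pi R (1/6) - 1.
Proof.
have E : e2pi R (1/6) ^+ 3 = -1.
  by rewrite -e2piX -(e2pi_half R) (_ : 1/6 *+ 3 = 1/2 :> rat).
apply/eqP; rewrite -subr_eq0; apply/eqP.
have : e2pi R (1/6) != -1 by rewrite -(e2pi_half R) e2pi_neq.
rewrite -subr_eq0 => /mulfI; apply.
by rewrite mulr0 -[RHS](subrr (-1)) -{3}E; ring.
Qed.

(** The numbers e^{2 pi i a} and e^{2 pi i b} are the roots of X^2 + uX + 1. *)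
Definition conj_pair (R : realType) (u : int) (a b : rat) :=
  e2pi R a + e2pi R b = - u%:~R /\ e2pi R a * e2pi R b = 1.

Lemma pair_third (R : realType) : conj_pair R 1 (1/3) (2/3).
Proof.
have E := e2pi_third R.
have E2 : e2pi R (2/3) = e2pi R (1/3) ^+ 2.
  by rewrite -e2piX (_ : 1/3 *+ 2 = 2/3 :> rat).
split; rewrite E2; first by apply/eqP; rewrite -subr_eq0 -E; apply/eqP; ring.
by rewrite -exprS -e2piX -(e2pi1 R) (_ : 1/3 *+ 3 = 1 :> rat).
Qed.

Lemma pair_quarter (R : realType) : conj_pair R 0 (1/4) (3/4).
Proof.
have E := e2pi_quarter R.
have E3 : e2pi R (3/4) = - e2pi R (1/4).
  by rewrite -mulN1r -E -exprSr -e2piX (_ : 1/4 *+ 3 = 3/4 :> rat).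
by split; rewrite E3 ?subrr ?oppr0 // mulrN -expr2 E opprK.
Qed.

Lemma pair_sixth (R : realType) : conj_pair R (-1) (1/6) (5/6).
Proof.
have E := e2pi_sixth R.
have E5 : e2pi R (5/6) = 1 - e2pi R (1/6).
  rewrite (_ : 5/6 = 1/6 *+ 2 + 1/2 :> rat) //.
  by rewrite e2piD e2piX E e2pi_half mulrN1 opprB.
split; rewrite E5; first by rewrite rmorphN opprK; ring.
by rewrite mulrBr mulr1 -expr2 E; ring.
Qed.

Lemma pair_zero (R : realType) : conj_pair R (-2) 0 0.
Proof. by rewrite /conj_pair e2pi0; split; [ring|rewrite mulr1]. Qed.
Lemma pair_half (R : realType) : conj_pair R 2 (1/2) (1/2).
Proof. by rewrite /conj_pair e2pi_half; split; ring. Qed.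

Lemma pair_plus (R : realType) t a b : conj_pair R t a b -> is_plus R t [tuple a; 1/2; b].
Proof.
move=> [S P]; rewrite /is_plus exp_poly3 e2pi_half map_poly_plus.
move: S P; set x := e2pi R a; set y := e2pi R b => S P.
congr (Poly [:: _; _; _; _]).
- by rewrite mulrN1 mulNr P opprK.
- by rewrite mulrN1 mulN1r [y * x]mulrC P -[t%:~R]opprK -S; ring.
- by rewrite -[t%:~R]opprK -S; ring.
Qed.

Lemma pair_minus (R : realType) s a b : conj_pair R s a b -> is_minus R s [tuple 0; a; b].
Proof.
move=> [S P]; rewrite /is_minus exp_poly3 e2pi0 map_poly_minus.
move: S P; set x := e2pi R a; set y := e2pi R b => S P.
congr (Poly [:: _; _; _; _]).
- by rewrite mul1r P.
- by rewrite mul1r P mulr1 -S; ring.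
- by rewrite -[s%:~R]opprK -S; ring.
Qed.

Lemma int_range4 (P : int -> Prop) (a : int) : P a -> P (a + 1) -> P (a + 2) -> P (a + 3) ->
  forall t, a <= t <= a + 3 -> P t.
Proof.
move=> h0 h1 h2 h3 t ht.
have : t = a \/ t = a + 1 \/ t = a + 2 \/ t = a + 3 by lia.
by case=> [->|[->|[->|->]]].
Qed.

Lemma angles_plusP (R : realType) (t : int) : -1 <= t <= 2 -> is_plus R t (angles_plus t).
Proof.
move: t; apply: int_range4; apply: pair_plus.
- exact: pair_sixth.
- exact: pair_quarter.
- exact: pair_third.
- exact: pair_half.
Qed.

Lemma angles_minusP (R : realType) (s : int) : -2 <= s <= 1 -> is_minus R s (angles_minus s).
Proof.
move: s; apply: int_range4; apply: pair_minus.
- exact: pair_zero.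
- exact: pair_sixth.
- exact: pair_quarter.
- exact: pair_third.
Qed.

Lemma all_tuple3 (T : Type) (P : pred T) a b c : P a -> P b -> P c -> all P [tuple a; b; c].
Proof. by move=> /= -> -> ->. Qed.

Lemma angles_plus_range t : all (fun a => 0 <= a < 1) (angles_plus t).
Proof.
by rewrite /angles_plus; do 3?[case: ifP => _]; apply: all_tuple3; apply/andP; split; lra.
Qed.
Lemma angles_minus_range t : all (fun a => 0 <= a < 1) (angles_minus t).
Proof.
by rewrite /angles_minus; do 3?[case: ifP => _]; apply: all_tuple3; apply/andP; split; lra.
Qed.

Lemma is_plus_perm (R : realType) t (alpha : 3.-tuple rat) : -1 <= t <= 2 ->
  all (fun a => 0 <= a < 1) alpha -> is_plus R t alpha -> perm_eq alpha (angles_plus t).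
Proof.
move=> ht ha Ea; apply: (@exp_poly_perm R) => //; first exact: angles_plus_range.
by rewrite -/(exp_poly R alpha) Ea -(angles_plusP R t ht).
Qed.
Lemma is_minus_perm (R : realType) s (alpha : 3.-tuple rat) : -2 <= s <= 1 ->
  all (fun a => 0 <= a < 1) alpha -> is_minus R s alpha -> perm_eq alpha (angles_minus s).
Proof.
move=> ht ha Ea; apply: (@exp_poly_perm R) => //; first exact: angles_minus_range.
by rewrite -/(exp_poly R alpha) Ea -(angles_minusP R s ht).
Qed.

(** * Primitivity *)

(** Away from i, f permutes the two remaining points. *)
Lemma fixpoint_involution (f : 'I_3 -> 'I_3) i : injective f -> f i = i ->
  forall x, f (f x) = x.
Proof.
move=> finj fi x.
have [->|xi] := eqVneq x i; first by rewrite !fi.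
have [fx|fx] := eqVneq (f x) x; first by rewrite !fx.
have fxi : f x != i by rewrite -{1}fi (inj_eq finj).
have h1 : f (f x) != i by rewrite -{1}fi (inj_eq finj).
have h2 : f (f x) != f x by rewrite (inj_eq finj).
apply/val_inj; move: xi fx fxi h1 h2; rewrite -!val_eqE /=.
by move: (ltn_ord x) (ltn_ord i) (ltn_ord (f x)) (ltn_ord (f (f x))); lia.
Qed.

(** Since b has order at most 2, the third condition says that a has a fixed
    point j.  If a and b had no common fixed point, a k = b k would differ from j
    and from the fixed point i of b, and would have to be k. *)
Lemma common_fixpoint (a b : 'I_3 -> 'I_3) : injective a -> injective b ->
  (exists i, b i = i) -> (exists j, a j = b j) -> (exists k, a (b (b k)) = k) ->
  exists i, a i = i /\ b i = i.
Proof.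
move=> ainj binj [i bi] [k abk] [j abbj].
have aj : a j = j by move: abbj; rewrite (fixpoint_involution b i).
have [ij|ij] := eqVneq i j; first by exists j; rewrite -{3 4}ij.
have [ki|ki] := eqVneq k i; first by exists k; rewrite abk ki.
have [kj|kj] := eqVneq k j; first by exists k; rewrite -abk kj.
have akj : a k != j by rewrite -{1}aj (inj_eq ainj).
have aki : a k != i by rewrite abk -{1}bi (inj_eq binj).
have ak : a k = k.
  apply/val_inj; move: ij ki kj akj aki; rewrite -!val_eqE /=.
  by move: (ltn_ord i) (ltn_ord j) (ltn_ord k) (ltn_ord (a k)); lia.
by exists k; rewrite -abk ak.
Qed.

Definition maps_blocks {K : fieldType} {n k} (V : 'I_k -> {vspace 'cV[K]_n})
  (h : 'M[K]_n) (f : 'I_k -> 'I_k) :=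
  forall i x, x \in V i -> h *m x \in V (f i).

Lemma maps_blocks_mul {K : fieldType} {n k} (V : 'I_k -> {vspace 'cV[K]_n}) g h a b :
  maps_blocks V g a -> maps_blocks V h b ->
  maps_blocks V (g *m h) (a \o b).
Proof. by move=> Hg Hh i x /Hh /Hg; rewrite mulmxA. Qed.

Lemma dim1_vline {K : fieldType} {vT : vectType K} (U : {vspace vT}) :
  \dim U = 1%N -> exists2 v, v != 0 & U = <[v]>%VS.
Proof.
move=> dU; have v0 : vpick U != 0 by rewrite vpick0 -dimv_eq0 dU.
exists (vpick U) => //; apply/esym/eqP.
by rewrite eqEdim -memvE memv_pick dU dim_vline v0.
Qed.

(** In a basis adapted to the lines, the matrix of h has zero diagonal. *)
Lemma trace_permuted_lines {K : fieldType} {n} (V : 'I_n -> {vspace 'cV[K]_n}) h f :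
  (forall i, \dim (V i) = 1%N) -> (\sum_i V i = fullv)%VS ->
  maps_blocks V h f -> (forall i, f i != i) -> \tr h = 0.
Proof.
move=> dV sV hV ff.
have /choice [v Hv] i : exists v, V i = <[v]>%VS.
  by have [v _ Ev] := dim1_vline (V i) (dV i); exists v.
have /choice [c Hc] i : exists c, h *m v i = c *: v (f i).
  by apply/vlineP; rewrite -Hv; apply: hV; rewrite Hv memv_line.
pose U : 'M[K]_n := \matrix_(a, i) v i a 0.
have UE (w : 'cV[K]_n) : U *m w = \sum_i w i 0 *: v i.
  apply/matrixP => a b; rewrite !mxE summxE; apply: eq_bigr => i _.
  by rewrite !mxE (ord1 b) mulrC.
have /choice [w Hw] j : exists w : 'cV[K]_n, U *m w = delta_mx j 0.
  have : delta_mx j 0 \in (\sum_i V i)%VS by rewrite sV memvf.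
  case/memv_sumP => u Hu ->.
  have /choice [d Hd] i : exists d, u i = d *: v i.
    by apply/vlineP; rewrite -Hv; apply: Hu.
  exists (\col_i d i); rewrite UE; apply: eq_bigr => i _.
  by rewrite mxE -Hd.
pose W : 'M[K]_n := \matrix_(a, j) w j a 0.
have UW : U *m W = 1%:M.
  apply: mulmx_ext => x; rewrite -mulmxA mul1mx.
  have -> : W *m x = \sum_j x j 0 *: w j.
    apply/matrixP => a b; rewrite !mxE summxE; apply: eq_bigr => i _.
    by rewrite !mxE (ord1 b) mulrC.
  rewrite mulmx_sumr; apply/matrixP => a b; rewrite summxE (ord1 b).
  rewrite (bigD1 a) //= -scalemxAr Hw !mxE !eqxx mulr1 big1 ?addr0 // => i ia.
  by rewrite -scalemxAr Hw !mxE eq_sym (negPf ia) mulr0.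
pose M : 'M[K]_n := \matrix_(a, i) (c i * (a == f i)%:R).
have hU : h *m U = U *m M.
  apply: mulmx_ext => x; rewrite -!mulmxA !UE mulmx_sumr.
  transitivity (\sum_i (x i 0 * c i) *: v (f i)).
    by apply: eq_bigr => i _; rewrite -scalemxAr Hc scalerA.
  transitivity (\sum_i \sum_a (if a == f i then (x i 0 * c i) *: v a else 0)).
    by apply: eq_bigr => i _; rewrite -big_mkcond big_pred1_eq.
  rewrite exchange_big /=; apply: eq_bigr => a _; rewrite mxE scaler_suml.
  apply: eq_bigr => i _; rewrite mxE; case: eqP => _; last by rewrite mulr0 mul0r scale0r.
  by rewrite mulr1 mulrC.
have WU : W *m U = 1%:M by exact: mulmx1C.
rewrite -[h]mulmx1 -UW mulmxA hU -mulmxA mxtrace_mulC -mulmxA WU mulmx1.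
by rewrite /mxtrace big1 // => i _; rewrite mxE eq_sym (negPf (ff i)) mulr0.
Qed.

Lemma mxtrace_col3 {K : nzRingType} (M : 'M[K]_3) :
  \tr M = (M *m col3 1 0 0) 0 0 + (M *m col3 0 1 0) 1 0 + (M *m col3 0 0 1) 2%:R 0.
Proof.
have E (x y z : K) i : (M *m col3 x y z) i 0 = M i 0 * x + M i 1 * y + M i 2%:R * z.
  rewrite mxE !big_ord_recl big_ord0 !mxE /= addr0 !addrA.
  by congr (M i _ * _ + M i _ * _ + M i _ * _); apply/val_inj.
rewrite !E !(mulr0, mulr1, addr0, add0r) /mxtrace !big_ord_recl big_ord0 addr0 addrA.
by congr (M _ _ + M _ _ + M _ _); apply/val_inj.
Qed.

Lemma trace_mxB {K : comUnitRingType} (s : int) : \tr (mxB s : 'M[K]_3) = (1 - s)%:~R.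
Proof.
rewrite mxtrace_col3 !mxB_col3 !mxE /= rmorphB /=; ring.
Qed.
Lemma trace_reflection {K : comUnitRingType} (s t : int) :
  \tr (invmx (mxA t) *m mxB s : 'M[K]_3) = 1.
Proof.
rewrite mxA_inv mxtrace_col3 -!mulmxA !(mxB_col3, flip_col3, mxA_col3) !mxE /=; ring.
Qed.
Lemma trace_ABB {K : comUnitRingType} (s t : int) :
  \tr (mxA t *m (mxB s *m mxB s) : 'M[K]_3) =
  (-1 + 3 * s - s ^+ 3 + (1 - s) ^+ 2 * (s - t))%:~R.
Proof.
rewrite mxtrace_col3 -!mulmxA !(mxB_col3, mxA_col3) !mxE /=.
rewrite !(rmorphD, rmorphB, rmorphM, rmorphXn, rmorphN) /=; ring.
Qed.

(** The first and last rows give m = - l; eliminating y then yields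
    2x = (2 + d) z and 2z = (2 + d) x with d = t - s, hence d (d + 4) = 0. *)
Lemma no_common_eigenvector {K : numFieldType} (s t : int) (v : 'cV[K]_3) l m :
  s < t -> mxA t *m v = l *: v -> mxB s *m v = m *: v -> v = 0.
Proof.
move=> st.
rewrite [v]col3_eta; move: (v 0 0) (v 1 0) (v 2%:R 0) => x y z.
rewrite mxA_col3 mxB_col3 => /matrixP EA /matrixP EB.
move: (EA 0 0) (EA 1 0) (EA 2%:R 0) (EB 0 0) (EB 1 0) (EB 2%:R 0).
rewrite !mxE /= => a0 a1 a2 b0 b1 b2.
have [z0|z0] := eqVneq z 0.
  have y0 : y = 0 by move: a2; rewrite z0 !mulr0 subr0.
  have x0 : x = 0 by move: a1; rewrite z0 y0 !mulr0 subr0.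
  by rewrite x0 y0 z0; apply/matrixP => i j; rewrite !mxE; case: i => [[|[|[|//]]] ?].
have x0 : x != 0 by apply: contraNneq z0 => x0; rewrite b0 x0 mulr0.
have ml : m = - l.
  by apply: (mulIf x0); rewrite mulNr -a0 opprK b0.
exfalso.
have e1 : 2 * x = (2 + (t - s)%:~R) * z.
  rewrite rmorphB /=; apply/eqP; rewrite -subr_eq0; apply/eqP.
  transitivity ((x - (1 + t%:~R) * z) + (x - (1 - s%:~R) * z)); first by ring.
  by rewrite a1 b1 ml; ring.
have e2 : 2 * l = - (2 + (t - s)%:~R).
  apply: (mulIf z0); rewrite rmorphB /=.
  transitivity (l * z - m * z); first by rewrite ml; ring.
  by rewrite -a2 -b2; ring.
have e3 : 2 * z = (2 + (t - s)%:~R) * x.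
  by rewrite -[z]opprK a0 mulrN mulrA e2; ring.
have : ((t - s) * (t - s + 4))%:~R * z = 0 :> K.
  rewrite rmorphM /= (rmorphD _ (t - s) 4) /=.
  move: e1 e3; set d := (t - s)%:~R => e1 e3.
  transitivity ((2 + d) * ((2 + d) * z) - 2 * (2 * z)); first by ring.
  by rewrite -e1 e3; ring.
move/eqP; rewrite mulf_eq0 (negPf z0) orbF intr_eq0 mulf_eq0.
by lia.
Qed.

(** A system of two blocks has one block of dimension 1, fixed by the group for
    reasons of dimension; in a system of three lines, the traces of B, A^-1 B and
    A B^2 provide the fixed lines required by [common_fixpoint]. *)
Lemma hgK_primitive {K : numFieldType} (s t : int) : s < t -> s != 1 ->
  -1 + 3 * s - s ^+ 3 + (1 - s) ^+ 2 * (s - t) != 0 ->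
  primitive_group (hgK s t : set 'M[K]_3).
Proof.
move=> st s1 tr0 [k [V [k1 dV sV /directvP dsV HV]]].
have HA : hgK s t (mxA t : 'M[K]_3) by apply: gen_group_in; left.
have HB : hgK s t (mxB s : 'M[K]_3) by apply: gen_group_in; right.
have [a Ha] := HV _ HA; have [b Hb] := HV _ HB.
have mapsE h (c : 'S_k) : (forall i, (linfun (mulmx h) @: V i)%VS = V (c i)) ->
    maps_blocks V h c.
  by move=> Hc i x Hx; rewrite -Hc; have := memv_img (linfun (mulmx h)) Hx; rewrite lfunE.
have mA := mapsE _ _ Ha; have mB := mapsE _ _ Hb.
have dim_perm h (c : 'S_k) : h \in unitmx ->
    (forall i, (linfun (mulmx h) @: V i)%VS = V (c i)) -> forall i, \dim (V (c i)) = \dim (V i).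
  move=> uh Hc i; rewrite -Hc limg_dim_eq //.
  suff -> : lker (linfun (mulmx h : 'cV[K]_3 -> 'cV[K]_3)) = 0%VS by rewrite capv0.
  apply/eqP/lker0P => x y; rewrite !lfunE /= => E.
  by rewrite -[x](mulKmx uh) E mulKmx.
have dimsum : (\sum_i \dim (V i) = 3)%N by have /= := dsV; rewrite sV dimvf => <-.
suff [i [di ai bi]] : exists i, [/\ \dim (V i) = 1%N, a i = i & b i = i].
  have [v v0 Ev] := dim1_vline _ di.
  have vV : v \in V i by rewrite Ev memv_line.
  have : mxA t *m v \in V i by rewrite -ai; apply: mA.
  have : mxB s *m v \in V i by rewrite -bi; apply: mB.
  rewrite Ev => /vlineP [m Em] /vlineP [l El].
  by move: v0; rewrite (no_common_eigenvector _ _ _ _ _ st El Em) eqxx.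
have k3 : (k <= 3)%N.
  by rewrite -dimsum -[k in (k <= _)%N]card_ord -sum1_card leq_sum.
have uA := @mxA_unit K t; have uB := @mxB_unit K s.
have dA := dim_perm _ _ uA Ha; have dB := dim_perm _ _ uB Hb.
move: k1 k3; rewrite leq_eqVlt => /orP[/eqP k2 _|k3 k3'].
  subst k; move: dimsum; rewrite !big_ord_recl big_ord0 addn0 => dimsum.
  have i2 (i : 'I_2) : i = ord0 \/ i = lift ord0 ord0.
    by case: i => [[|[|//]] ?]; [left|right]; apply: val_inj.
  have fixed (c : 'S_2) : (forall i, \dim (V (c i)) = \dim (V i)) -> forall i, c i = i.
    move=> dc i; move: (dc i) (i2 i) (i2 (c i)) => di.
    by case=> Ei [] Ec; move: di; rewrite Ec Ei //; lia.
  have : \dim (V ord0) = 1%N \/ \dim (V (lift ord0 ord0)) = 1%N.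
    by move: (dV ord0) (dV (lift ord0 ord0)); lia.
  by case=> d1; [exists ord0|exists (lift ord0 ord0)]; rewrite !fixed.
have Ek : k = 3%N by apply/eqP; rewrite eqn_leq k3' k3.
subst k; move: dimsum; rewrite !big_ord_recl big_ord0 addn0 => dimsum.
have d1 i : \dim (V i) = 1%N.
  have : i = ord0 \/ i = lift ord0 ord0 \/ i = lift ord0 (lift ord0 ord0).
    by case: i => [[|[|[|//]]] ?]; [left|right; left|right; right]; apply: val_inj.
  move: (dV ord0) (dV (lift ord0 ord0)) (dV (lift ord0 (lift ord0 ord0))).
  by move=> ? ? ? [->|[->|->]]; lia.
have fix_of h f : maps_blocks V h f -> \tr h != 0 -> exists i, f i = i.
  move=> hf; apply: contraNP => nofix; apply/eqP.
  apply: (trace_permuted_lines _ _ _ d1 sV hf) => i.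
  by apply/eqP => fi; apply: nofix; exists i.
have mAi : maps_blocks V (invmx (mxA t)) (a^-1)%g.
  move=> i x; rewrite -{1}(permKV a i) -Ha => /memv_imgP [y Hy ->].
  by rewrite lfunE /= mulKmx.
have [|||i [ai bi]] := @common_fixpoint a b (@perm_inj _ a) (@perm_inj _ b).
- apply: fix_of mB _; rewrite trace_mxB intr_eq0; lia.
- have [|i Ei] := fix_of _ _ (maps_blocks_mul _ _ _ _ _ mAi mB).
    by rewrite trace_reflection oner_eq0.
  by exists i; rewrite -{1}Ei /= permKV.
- by apply: fix_of (maps_blocks_mul _ _ _ _ _ mA (maps_blocks_mul _ _ _ _ _ mB mB)) _;
    rewrite trace_ABB intr_eq0.
by exists i.
Qed.

(** * The six groups *)

Lemma hgK_arithmetic (R : realType) (s t : int) : -2 <= s -> s < t -> t <= 2 ->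
  is_arithmetic (hgK s t : set 'M[R[i]]_3).
Proof.
move=> hs hst ht; exists (gram s t); first exact: hgK_hyperbolic.
split.
  rewrite hgK_int => _ [g Hg <-]; exists g => //.
  have Kg : hgK s t (map_mx intr g : 'M[R[i]]_3) by rewrite hgK_int; exists g.
  split; last exact: hgK_preserves.
  by have [] := hgZ_ortho _ _ _ Hg.
have [T finT HT] := orthoZ_cosets s t hs hst ht.
pose coset (u : 'M[int]_3) : set 'M[R[i]]_3 :=
  [set (map_mx intr u : 'M[R[i]]_3) *m h | h in hgK s t].
apply: (@sub_finite_set _ _ (coset @` T)); last exact: finite_image.
move=> _ [_ [g [ug pg] <-] <-].
have Og : orthoZ s t g.
  split=> // x; apply: (@intr_inj R[i]).
  by rewrite -!qform_hformZ map_mxM pg.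
have [h [u [Hh Tu Eg]]] := HT g Og; exists u => //.
have Kh : hgK s t (map_mx intr h : 'M[R[i]]_3) by rewrite hgK_int; exists h.
have uh : (map_mx intr h : 'M[R[i]]_3) \in unitmx.
  have [uh _] := hgZ_ortho _ _ _ Hh.
  have /mulmx1_unit [] // : (map_mx intr h : 'M[R[i]]_3) *m map_mx intr (invmx h) = 1%:M.
  by rewrite -map_mxM mulmxV // map_mx1.
apply/seteqP; split=> _ [k Kk <-].
- exists (invmx (map_mx intr h) *m k); first by apply: gen_group_mul => //; exact: gen_group_inv.
  by rewrite Eg map_mxM -mulmxA mulKVmx.
- exists (map_mx intr h *m k); first exact: gen_group_mul.
  by rewrite Eg map_mxM mulmxA.
Qed.

Lemma shift1_eq (d a b : rat) (m : int) : 0 <= b < 1 -> a + d = b + m%:~R -> shift1 d a = b.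
Proof.
move=> /andP[b0 b1] E; rewrite /shift1.
suff -> : Num.floor (a + d) = m by rewrite E addrK.
by apply: floor_def; rewrite E intrD; lra.
Qed.

Lemma shift1_0 (u : seq rat) : all (fun a => 0 <= a < 1) u -> map (shift1 0) u = u.
Proof.
move=> /allP Hu; rewrite -[RHS]map_id; apply/eq_in_map => a /Hu ha.
by apply: (@shift1_eq _ _ _ 0); rewrite ?addr0.
Qed.

Lemma rot_perm (T : eqType) (s1 s2 : seq T) k : rot k s1 = s2 -> perm_eq s1 s2.
Proof. by move=> <-; rewrite perm_sym perm_rot. Qed.

(** Shifting by 1/2 negates the roots, and P_t(-X) = - Q_{-t}(X).  On the explicit
    angles the shift is moreover a cyclic rotation of the triple. *)
Lemma shift_half_plus t : -1 <= t <= 2 ->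
  perm_eq (angles_minus (- t)) (map (shift1 (1/2)) (angles_plus t)).
Proof.
move: t; apply: int_range4; rewrite perm_sym; apply: (@rot_perm _ _ _ 1);
  congr [:: _; _; _];
  first [ by apply: (@shift1_eq _ _ _ 0); [apply/andP; split|]; lra
        | by apply: (@shift1_eq _ _ _ 1); [apply/andP; split|]; lra].
Qed.

Lemma shift_half_minus s : -2 <= s <= 1 ->
  perm_eq (angles_plus (- s)) (map (shift1 (1/2)) (angles_minus s)).
Proof.
move: s; apply: int_range4; rewrite perm_sym; apply: (@rot_perm _ _ _ 2);
  congr [:: _; _; _];
  first [ by apply: (@shift1_eq _ _ _ 0); [apply/andP; split|]; lra
        | by apply: (@shift1_eq _ _ _ 1); [apply/andP; split|]; lra].
Qed.

(** The pairs (s, t) of the list, in its order. *)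
Definition six_parameters : seq (int * int) :=
  [:: (-2, 2); (-2, 1); (-2, 0); (-2, -1); (0, 1); (-1, 1)].

Lemma hg_sixE : hg_six = [seq (angles_plus st.2, angles_minus st.1) | st <- six_parameters].
Proof. by []. Qed.

Lemma six_or_twist (s t : int) : -2 <= s <= 1 -> -1 <= t <= 2 -> s < t ->
  ((s, t) \in six_parameters) || ((- t, - s) \in six_parameters).
Proof.
move=> hs ht; move: s hs; apply: int_range4; move: t ht; apply: int_range4 => //.
Qed.

Lemma hg_equivC n (alpha beta alpha' beta' : n.-tuple rat) :
  hg_equiv alpha beta alpha' beta' -> hg_equiv alpha beta beta' alpha'.
Proof. by case=> d [[h1 h2]|[h1 h2]]; exists d; [right|left]. Qed.

Lemma hg_six_complete (R : realType) (s t : int) (alpha beta : 3.-tuple rat) :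
  -2 <= s <= 1 -> -1 <= t <= 2 -> s < t ->
  all (fun a => 0 <= a < 1) alpha -> all (fun a => 0 <= a < 1) beta ->
  is_plus R t alpha -> is_minus R s beta ->
  exists2 r, r \in hg_six & hg_equiv r.1 r.2 alpha beta.
Proof.
move=> hs ht st ra rb Pa Mb.
have pa := is_plus_perm _ _ _ ht ra Pa; have pb := is_minus_perm _ _ _ hs rb Mb.
rewrite hg_sixE; case/orP: (six_or_twist s t hs ht st) => H.
  exists (angles_plus t, angles_minus s); first by apply/mapP; exists (s, t).
  exists 0; left; rewrite !shift1_0 //; [exact: angles_minus_range|exact: angles_plus_range].
exists (angles_plus (- s), angles_minus (- t)); first by apply/mapP; exists (- t, - s).
exists (1/2); right; split.
- apply: perm_trans pa _; rewrite -{1}[t]opprK; apply: shift_half_minus; lia.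
- apply: perm_trans pb _; rewrite -{1}[s]opprK; apply: shift_half_plus; lia.
Qed.

Lemma prod_Phi (n : nat) : (0 < n)%N ->
  \prod_(d <- divisors n) 'Phi_d = 'X^n - 1 :> {poly int}.
Proof. exact: prod_Cyclotomic. Qed.

Lemma Xsub1_neq0 : 'X - 1 != 0 :> {poly int}.
Proof. by rewrite -polyC1 polyXsubC_eq0. Qed.
Lemma Xadd1_neq0 : 'X + 1 != 0 :> {poly int}.
Proof. by rewrite -polyC1 -[_%:P]opprK -polyCN polyXsubC_eq0. Qed.

Lemma Phi1 : 'Phi_1 = 'X - 1.
Proof. by have := prod_Phi 1 isT; rewrite big_cons big_nil mulr1. Qed.
Lemma Phi2 : 'Phi_2 = 'X + 1.
Proof.
have := prod_Phi 2 isT; rewrite -[divisors 2]/[:: 1; 2]%N !big_cons big_nil mulr1 Phi1 => E.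
by apply: (mulfI Xsub1_neq0); rewrite E; ring.
Qed.
Lemma Phi3 : 'Phi_3 = 'X^2 + 'X + 1.
Proof.
have := prod_Phi 3 isT; rewrite -[divisors 3]/[:: 1; 3]%N !big_cons big_nil mulr1 Phi1 => E.
by apply: (mulfI Xsub1_neq0); rewrite E; ring.
Qed.
Lemma Phi4 : 'Phi_4 = 'X^2 + 1.
Proof.
have := prod_Phi 4 isT.
rewrite -[divisors 4]/[:: 1; 2; 4]%N !big_cons big_nil mulr1 Phi1 Phi2 => E.
by apply: (mulfI Xadd1_neq0); apply: (mulfI Xsub1_neq0); rewrite E; ring.
Qed.
Lemma X2X1_neq0 : 'X^2 + 'X + 1 != 0 :> {poly int}.
Proof. by rewrite -Phi3 monic_neq0 ?Cyclotomic_monic. Qed.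
Lemma Phi6 : 'Phi_6 = 'X^2 - 'X + 1.
Proof.
have := prod_Phi 6 isT.
rewrite -[divisors 6]/[:: 1; 2; 3; 6]%N !big_cons big_nil mulr1 Phi1 Phi2 Phi3 => E.
by apply: (mulfI X2X1_neq0); apply: (mulfI Xadd1_neq0); apply: (mulfI Xsub1_neq0); rewrite E; ring.
Qed.

Lemma poly_plusE t : poly_plus t = ('X + 1) * ('X^2 + t%:P * 'X + 1).
Proof. rewrite /poly_plus /= !cons_poly_def !(polyCD, polyC1, polyC0); ring. Qed.
Lemma poly_minusE s : poly_minus s = ('X - 1) * ('X^2 + s%:P * 'X + 1).
Proof. rewrite /poly_minus /= !cons_poly_def !(polyCD, polyCN, polyC1, polyC0); ring. Qed.

Lemma poly_plus_cyclotomic t : -1 <= t <= 2 ->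
  exists2 u, all (ltn 0) u & poly_plus t = \prod_(k <- u) 'Phi_k.
Proof.
move: t; apply: int_range4; rewrite poly_plusE.
- by exists [:: 2; 6]%N => //; rewrite !big_cons big_nil Phi2 Phi6 polyCN; ring.
- by exists [:: 2; 4]%N => //; rewrite !big_cons big_nil Phi2 Phi4; ring.
- by exists [:: 2; 3]%N => //; rewrite !big_cons big_nil Phi2 Phi3; ring.
- by exists [:: 2; 2; 2]%N => //; rewrite !big_cons big_nil Phi2; ring.
Qed.

Lemma poly_minus_cyclotomic s : -2 <= s <= 1 ->
  exists2 u, all (ltn 0) u & poly_minus s = \prod_(k <- u) 'Phi_k.
Proof.
move: s; apply: int_range4; rewrite poly_minusE.
- by exists [:: 1; 1; 1]%N => //; rewrite !big_cons big_nil Phi1; ring.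
- by exists [:: 1; 6]%N => //; rewrite !big_cons big_nil Phi1 Phi6; ring.
- by exists [:: 1; 4]%N => //; rewrite !big_cons big_nil Phi1 Phi4; ring.
- by exists [:: 1; 3]%N => //; rewrite !big_cons big_nil Phi1 Phi3; ring.
Qed.

Lemma poly_no_common_root {K : numFieldType} (s t : int) (z : K) :
  s != 2 -> t != -2 -> s != t ->
  (map_poly intr (poly_plus t)).[z] = 0 -> (map_poly intr (poly_minus s)).[z] = 0 -> False.
Proof.
move=> s2 t2 st; rewrite horner_plus horner_minus => /eqP + /eqP.
rewrite !mulf_eq0 => /orP[/eqP z1|/eqP qt] /orP[/eqP z1'|/eqP qs].
- have : 2 = 0 :> K by rewrite -z1 -[X in X = _]addr0 -{1}z1'; ring.
  by move/eqP; rewrite pnatr_eq0.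
- have : (2 - s)%:~R = 0 :> K.
    rewrite -qs rmorphB /=; have -> : z = -1 by rewrite -[z](addrK 1) z1 add0r.
    ring.
  by move/eqP; rewrite intr_eq0 subr_eq0 eq_sym (negPf s2).
- have : (2 + t)%:~R = 0 :> K.
    rewrite -qt rmorphD /=; have -> : z = 1 by rewrite -[z](subrK 1) z1' add0r.
    ring.
  by move/eqP; rewrite intr_eq0 addrC -[X in t + X]opprK subr_eq0 (negPf t2).
- have : (s - t)%:~R * z = 0 :> K.
    by rewrite rmorphB /= -[RHS](subrr 0) -{1}qs -qt; ring.
  move/eqP; rewrite mulf_eq0 intr_eq0 subr_eq0 (negPf st) /= => /eqP z0.
  by move/eqP: qs; rewrite z0 expr0n mulr0 !add0r oner_eq0.
Qed.

Lemma angles_hg_data (R : realType) (s t : int) : -2 <= s <= 1 -> -1 <= t <= 2 -> s != t ->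
  hg_data R (angles_plus t) (angles_minus s).
Proof.
move=> hs ht st; have Ep := angles_plusP R t ht; have Em := angles_minusP R s hs.
split.
- by split; [exact: angles_plus_range|exact: angles_minus_range].
- move=> i j; apply/eqP => E.
  have ev (u : 3.-tuple rat) k : (exp_poly R u).[e2pi R (tnth u k)] = 0.
    apply/rootP; rewrite /exp_poly -(big_map (e2pi R) xpredT (fun x => 'X - x%:P)).
    by rewrite root_prod_XsubC map_f ?mem_tnth.
  apply: (poly_no_common_root s t (e2pi R (tnth (angles_plus t) i))) => //; try lia.
  + by rewrite -Ep ev.
  + by rewrite -Em E ev.
- by have [u u0 E] := poly_plus_cyclotomic t ht; exists u; rewrite // Ep E.
- by have [u u0 E] := poly_minus_cyclotomic s hs; exists u; rewrite // Em E.
Qed.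

Lemma six_parameters_range (s t : int) : (s, t) \in six_parameters ->
  [/\ -2 <= s <= 1, -1 <= t <= 2, s < t, s != 1 &
   -1 + 3 * s - s ^+ 3 + (1 - s) ^+ 2 * (s - t) != 0].
Proof. by rewrite !inE => /or4P[|||/or3P[]] /eqP[-> ->]. Qed.

Lemma six_primitive (R : realType) (s t : int) : (s, t) \in six_parameters ->
  hg_data R (angles_plus t) (angles_minus s) /\
  primitive_group (hg_group R (angles_plus t) (angles_minus s)).
Proof.
move=> /six_parameters_range[hs ht st s1 tr0]; split.
  by apply: angles_hg_data => //; rewrite lt_eqF.
rewrite (hg_group_hgK _ s t) ?angles_plusP ?angles_minusP //.
- exact: hgK_primitive.
- exact: angles_plusP.
- exact: angles_minusP.
Qed.

Definition esum_norm (R : realType) (u : seq rat) : R[i] :=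
  let z := \sum_(a <- u) e2pi R a in z * conjc z.

Lemma esum_norm_perm (R : realType) u v : perm_eq u v -> esum_norm R u = esum_norm R v.
Proof. by move=> uv; rewrite /esum_norm (perm_big _ uv). Qed.

Lemma esum_norm_shift (R : realType) d u : esum_norm R (map (shift1 d) u) = esum_norm R u.
Proof.
rewrite /esum_norm big_map.
have -> : \sum_(a <- u) e2pi R (shift1 d a) = e2pi R d * \sum_(a <- u) e2pi R a.
  by rewrite mulr_sumr; apply: eq_bigr => a _; rewrite e2pi_shift.
by rewrite rmorphM /= mulrACA e2pi_conj mul1r.
Qed.

Lemma esum_norm_plus (R : realType) t (u : 3.-tuple rat) :
  is_plus R t u -> esum_norm R u = ((1 + t) ^+ 2)%:~R.
Proof.
have [a [b [c ->]]] := tuple3P _ u.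
rewrite /is_plus exp_poly3 map_poly_plus => /(congr1 (fun p : {poly R[i]} => p`_2)).
rewrite !coef_Poly /= => E; rewrite /esum_norm !big_cons big_nil addr0.
have -> : e2pi R a + (e2pi R b + e2pi R c) = (- (1 + t))%:~R.
  by rewrite rmorphN rmorphD /= -E opprK addrA.
by rewrite rmorph_int -rmorphM /= mulrNN.
Qed.

Lemma esum_norm_minus (R : realType) s (u : 3.-tuple rat) :
  is_minus R s u -> esum_norm R u = ((1 - s) ^+ 2)%:~R.
Proof.
have [a [b [c ->]]] := tuple3P _ u.
rewrite /is_minus exp_poly3 map_poly_minus => /(congr1 (fun p : {poly R[i]} => p`_2)).
rewrite !coef_Poly /= => E; rewrite /esum_norm !big_cons big_nil addr0.
have -> : e2pi R a + (e2pi R b + e2pi R c) = (1 - s)%:~R.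
  by rewrite rmorphB /= -[RHS]opprB -E opprK addrA.
by rewrite rmorph_int -rmorphM.
Qed.

Lemma esum_norm_eq (R : realType) (u v : int) : 0 <= u -> 0 <= v ->
  (u ^+ 2)%:~R = (v ^+ 2)%:~R :> R[i] -> u = v.
Proof.
by move=> u0 v0 /intr_inj/eqP; rewrite eqrXn2 // => /eqP.
Qed.

(** The squared moduli of the sums of roots are (1 + t)^2 and (1 - s)^2, with
    1 + t and 1 - s nonnegative; an equivalence preserves them, possibly in the
    other order, hence also their sum 2 + t - s. *)
Lemma equiv_indefinite (R : realType) (s0 t0 s t : int) (alpha beta : 3.-tuple rat) :
  -2 <= s0 <= 1 -> -1 <= t0 <= 2 -> s0 < t0 -> -2 <= s <= 1 -> -1 <= t <= 2 ->
  is_plus R t alpha -> is_minus R s beta ->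
  hg_equiv (angles_plus t0) (angles_minus s0) alpha beta -> s < t.
Proof.
move=> hs0 ht0 st0 hs ht Pa Mb [d E].
have Na := esum_norm_plus _ _ _ Pa; have Nb := esum_norm_minus _ _ _ Mb.
have Na0 := esum_norm_plus _ _ _ (angles_plusP R t0 ht0).
have Nb0 := esum_norm_minus _ _ _ (angles_minusP R s0 hs0).
case: E => -[/(esum_norm_perm R) + /(esum_norm_perm R)];
  rewrite !esum_norm_shift Na Nb Na0 Nb0 => /esum_norm_eq E1 /esum_norm_eq E2; lia.
Qed.

Theorem mainTheorem3 (R : realType) :
  (forall alpha beta : 3.-tuple rat,
     hg_data R alpha beta ->
     primitive_group (hg_group R alpha beta) ->
     ~ finite_set (hg_group R alpha beta) ->
     exists F : 'M[rat]_3,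
       hyperbolic_form (hg_group R alpha beta) F /\
       (forall G : 'M[rat]_3, G^T = G ->
          (forall h, hg_group R alpha beta h -> preserves G h) ->
          exists c : rat, G = c *: F)) /\
  (forall alpha beta : 3.-tuple rat,
     hg_data R alpha beta ->
     primitive_group (hg_group R alpha beta) ->
     hyperbolic (hg_group R alpha beta) ->
     exists2 r, r \in hg_six & hg_equiv r.1 r.2 alpha beta) /\
  (forall r, r \in hg_six ->
     hg_data R r.1 r.2 /\ primitive_group (hg_group R r.1 r.2)) /\
  (forall r, r \in hg_six ->
     forall alpha beta : 3.-tuple rat,
       hg_data R alpha beta ->
       hg_equiv r.1 r.2 alpha beta ->
       is_arithmetic (hg_group R alpha beta)).
Proof.
split; [|split; [|split]].
- move=> alpha beta data _.
  have [s [t [hs ht st ab]]] := hg_classify R _ _ data.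
  have -> : hg_group R alpha beta = hgK s t.
    by case: ab => -[Pa Mb]; [|rewrite hg_groupC]; exact: hg_group_hgK.
  move=> inf; exists (gram s t).
  have {}st : s < t.
    rewrite lt_neqAle st leNgt; apply/negP => ts.
    by apply: inf; apply: hgK_finite; lia.
  split; first by apply: hgK_hyperbolic; lia.
  by move=> G GT HG; apply: (gram_unique s t) HG => //; lia.
- move=> alpha beta data _.
  have [s [t [hs ht st ab]]] := hg_classify R _ _ data.
  have -> : hg_group R alpha beta = hgK s t.
    by case: ab => -[Pa Mb]; [|rewrite hg_groupC]; exact: hg_group_hgK.
  case=> F [FT _ sigF HF].
  have {}st : s < t.
    rewrite lt_neqAle st leNgt; apply/negP => ts.
    have [|c Ec] := gram_unique s t F _ FT HF; first by lia.
    by move: sigF; rewrite Ec; apply: definite_no_signature; lia.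
  case: data => -[ra rb] _ _ _.
  case: ab => -[Pa Mb]; first exact: (hg_six_complete R s t).
  have [r r6 E] := hg_six_complete R s t beta alpha hs ht st rb ra Pa Mb.
  by exists r => //; exact: hg_equivC.
- by move=> r; rewrite hg_sixE => /mapP[[s t] st ->]; exact: six_primitive.
- move=> r; rewrite hg_sixE => /mapP[[s0 t0] st0 ->] alpha beta data E.
  have [hs0 ht0 {}st0 _ _] := six_parameters_range _ _ st0.
  have [s [t [hs ht _ ab]]] := hg_classify R _ _ data.
  have -> : hg_group R alpha beta = hgK s t.
    by case: ab => -[Pa Mb]; [|rewrite hg_groupC]; exact: hg_group_hgK.
  have st : s < t.
    case: ab => -[Pa Mb].
      exact: (equiv_indefinite R s0 t0 s t alpha beta).
    by apply: (equiv_indefinite R s0 t0 s t beta alpha) => //; exact: hg_equivC.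
  by apply: hgK_arithmetic; lia.
Qed.
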